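(* Let $KB=(O,M)$ be a tightly coupled probabilistic $\mathcal{EL}^{++}$ ontology (TCP ontology), where $M$ is a conjunctive Markov logic network (cMLN), and let $a$ be a ground atom constructed from predicates and individuals in $KB$. The problem of deciding, given $KB$, $a$ and a threshold $k$, whether $\Pr^{KB}(a)\ge k$ is $PP$-hard in the data complexity.
   Context: **$\mathcal{EL}^{++}$.** Concepts are built from pairwise disjoint sets of atomic concept names, role names and individual names $\mathbf I$ by $\top$, $\bot$, nominals $\{a\}$, conjunction $C\sqcap D$, existential restriction $\exists r.C$, and concrete domain concepts $p(f_1,\dots,f_k)$ ($p$ a predicate of a concrete domain $\mathcal D_j$, $f_i$ feature names interpreted as partial functions into the concrete domains, which are pairwise disjoint), with the usual semantics. A TBox is a finite set of general concept inclusions $C\sqsubseteq D$, role inclusions $r_1\circ\cdots\circ r_k\sqsubseteq r$, domain restrictions $dom(r)\sqsubseteq C$ and range restrictions $ran(r)\sqsubseteq C$; an ABox is a finite set of assertions $C(a)$, $r(a,b)$. The standard syntactic restriction of Baader, Brandt and Lutz (2008) on the interplay of role inclusions and range restrictions is assumed: if $r_1\circ\cdots\circ r_k\sqsubseteq s$ with $k\ge 1$ is in the TBox and the TBox imposes $ran(s)\sqsubseteq C$ (directly or through a superrole of $s$), then it also imposes $ran(r_k)\sqsubseteq C$. Axioms and assertions are identified with their first-order translations. **MLNs and cMLNs.** Let $\Delta_{MLN}$ be a finite set of constants, $\mathcal V_{MLN}$ an infinite set of variables, and $\mathcal R_{MLN}$ a finite set of predicate symbols disjoint from the concept and role names. A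 Markov logic network (MLN) is a finite set $M$ of pairs $(F_j,w_j)$ with $F_j$ a first-order formula over these symbols and $w_j\in\mathbb R$. It is a conjunctive MLN (cMLN) if every $F_j$ is a conjunction of atoms. The Boolean random variables $X=\{X_1,\dots,X_n\}$ are the ground atoms over $\mathcal R_{MLN}$ and $\Delta_{MLN}$. For a truth assignment $x$ to $X$, $P(X=x)=\frac1Z\exp(\sum_j w_j n_j(x))$, where $n_j(x)$ is the number of ground instances of $F_j$ (over $\Delta_{MLN}$) true in $x$, and $Z=\sum_{x'}\exp(\sum_j w_j n_j(x'))$. **TCP ontologies.** A probabilistic annotation $\lambda$ relative to $M$ is a finite set of pairs $\langle A_i,x_i\rangle$, with $A_i$ an atom over $\mathcal R_{MLN},\mathcal V_{MLN},\Delta_{MLN}$ and $x_i\in\{0,1\}$, such that the atoms of no two distinct pairs are unifiable. If $|\lambda|=|X|$ and all atoms in $\lambda$ are ground, $\lambda$ is a (possible) world (i.e. a truth assignment to $X$); $\Pr_M(\lambda)$ is the probability of this assignment in $M$. A probabilistic $\mathcal{EL}^{++}$ axiom (annotated formula) is $F:\lambda$ with $F$ the first-order translation of an $\mathcal{EL}^{++}$ axiom or assertion and $\lambda$ an annotation; variables may be shared between $F$ and $\lambda$ (and are then instantiated together by a substitution), and constants in annotations may also be individuals of the ontology. A TCP ontology is $KB=(O,M)$ with $O$ a finite set of annotated formulas whose annotations are relative to the MLN $M$. **Semantics.** An interpretation is $\langle D,w\rangle$ with $D$ a database (set of ground atoms over $\mathbf I$ and labeled nulls) and $w$ a world. It satisfies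 $F:\lambda$ iff, whenever $\theta$ is a most general unifier such that for all $\langle V_i,x_i\rangle\in\lambda$ the atom $\theta V_i$ is a random variable to which $w$ assigns the value $x_i$, then $D\models\theta F$. A probabilistic interpretation $Pr$ is a probability distribution over interpretations with finite support; $Pr(F:\lambda)$ is the sum of $Pr(\mathcal I)$ over interpretations $\mathcal I$ satisfying $F:\lambda$. $Pr$ is a model of $KB=(O,M)$ (written $Pr\models KB$) iff (i) $Pr(F:\lambda)=1$ for every $F:\lambda\in O$, and (ii) $1-Pr(\mathit{false}:\lambda)=\Pr_M(\lambda)$ for every world $\lambda$. For a ground atom $a$, $\Pr^{KB}(a)$ is the infimum of $Pr(a:\{\})$ over all probabilistic interpretations $Pr$ with $Pr\models KB$. **Data complexity.** The set of formulas in the MLN and the TBox are considered fixed, while $\mathbf I$ and $\Delta_{MLN}$ (hence the ABox on the ontology side and the set of random variables on the MLN side) are not fixed and are part of the input. **PP** is the class of problems decidable by a probabilistic Turing machine in polynomial time with error probability less than $1/2$. *)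

(* Defs.v *)
From Stdlib Require List Relations.
From HB Require Import structures.
From mathcomp Require Import all_boot all_order all_algebra.
From mathcomp Require Import all_classical all_reals all_analysis.

Set Implicit Arguments.
Unset Strict Implicit.
Unset Printing Implicit Defensive.

Import Order.TTheory GRing.Theory Num.Theory.

(* Names are finite bit strings, so that they can be written on a tape. *)
Definition name : Type := seq bool.

(* Function-free terms; a sum type so that [term] is canonically an eqType. *)
Definition term : Type := (nat + name)%type.
Definition Var (v : nat) : term := inl v.
Definition Cst (c : name) : term := inr c.

Definition subst : Type := nat -> term.

Definition tsubst (theta : subst) (t : term) : term :=
  match t with inl v => theta v | inr c => Cst c end.

Inductive fo (P : Type) : Type :=
| FTrue
| FFalse
| FAtom of P & seq term
| FEq of term & term
| FNot of fo P
| FAnd of fo P & fo P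
| FOr of fo P & fo P
| FImp of fo P & fo P
| FAll of nat & fo P
| FEx of nat & fo P.

Arguments FTrue {P}.
Arguments FFalse {P}.
Arguments FEq {P}.

Definition term_fv (t : term) : seq nat :=
  match t with inl v => [:: v] | inr _ => [::] end.

Definition term_csts (t : term) : seq name :=
  match t with inl _ => [::] | inr c => [:: c] end.

Fixpoint fo_fv {P : Type} (F : fo P) : seq nat :=
  match F with
  | FTrue | FFalse => [::]
  | FAtom _ ts => flatten (map term_fv ts)
  | FEq t u => term_fv t ++ term_fv u
  | FNot G => fo_fv G
  | FAnd G H | FOr G H | FImp G H => fo_fv G ++ fo_fv H
  | FAll v G | FEx v G => [seq u <- fo_fv G | u != v]
  end.

Fixpoint fo_csts {P : Type} (F : fo P) : seq name :=
  match F with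
  | FTrue | FFalse => [::]
  | FAtom _ ts => flatten (map term_csts ts)
  | FEq t u => term_csts t ++ term_csts u
  | FNot G => fo_csts G
  | FAnd G H | FOr G H | FImp G H => fo_csts G ++ fo_csts H
  | FAll _ G | FEx _ G => fo_csts G
  end.

Fixpoint fo_atoms {P : Type} (F : fo P) : seq (P * seq term) :=
  match F with
  | FTrue | FFalse | FEq _ _ => [::]
  | FAtom p ts => [:: (p, ts)]
  | FNot G => fo_atoms G
  | FAnd G H | FOr G H | FImp G H => fo_atoms G ++ fo_atoms H
  | FAll _ G | FEx _ G => fo_atoms G
  end.

Inductive conj_of_atoms {P : Type} : fo P -> Prop :=
| conj_atom p ts : conj_of_atoms (FAtom p ts)
| conj_and F G : conj_of_atoms F -> conj_of_atoms G -> conj_of_atoms (FAnd F G).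

Definition upd {T : Type} (rho : nat -> T) (v : nat) (d : T) : nat -> T :=
  fun u => if u == v then d else rho u.

Definition eval {T : Type} (cst : name -> T) (rho : nat -> T) (t : term) : T :=
  match t with inl v => rho v | inr c => cst c end.

Fixpoint sat {P T : Type} (dom : T -> Prop) (cst : name -> T)
    (itp : P -> seq T -> Prop) (rho : nat -> T) (F : fo P) : Prop :=
  match F with
  | FTrue => True
  | FFalse => False
  | FAtom p ts => itp p (map (eval cst rho) ts)
  | FEq t u => eval cst rho t = eval cst rho u
  | FNot G => ~ sat dom cst itp rho G
  | FAnd G H => sat dom cst itp rho G /\ sat dom cst itp rho H
  | FOr G H => sat dom cst itp rho G \/ sat dom cst itp rho H
  | FImp G H => sat dom cst itp rho G -> sat dom cst itp rho H
  | FAll v G => forall d, dom d -> sat dom cst itp (upd rho v d) G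
  | FEx v G => exists2 d, dom d & sat dom cst itp (upd rho v d) G
  end.

(* [theta F], with its free variables universally quantified.  The
   substitution acts through the environment, hence without capture by the
   quantifiers of [F]. *)
Definition sat_inst {P T : Type} (dom : T -> Prop) (cst : name -> T)
    (itp : P -> seq T -> Prop) (theta : subst) (F : fo P) : Prop :=
  forall rho : nat -> T, (forall v, dom (rho v)) ->
    sat dom cst itp (fun v => eval cst rho (theta v)) F.

(* A predicate name without arity is not a predicate of the domain. *)
Record concrete_domain : Type := ConcreteDomain {
  cd_carrier : Type;
  cd_arity : name -> option nat;
  cd_holds : name -> seq cd_carrier -> Prop
}.

(* Concrete domains are indexed by ['I_nd]. *)
Inductive concept (nd : nat) : Type :=
| CTop
| CBot
| CNominal of name
| CName of name
| CAnd of concept nd & concept nd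
| CEx of name & concept nd
| CData of 'I_nd & name & seq name.

Arguments CTop {nd}.
Arguments CBot {nd}.
Arguments CNominal {nd}.
Arguments CName {nd}.

Inductive tbox_axiom (nd : nat) : Type :=
| GCI of concept nd & concept nd
| RoleIncl of seq name & name
| DomR of name & concept nd
| RanR of name & concept nd.

Arguments RoleIncl {nd}.

Inductive assertion (nd : nat) : Type :=
| AConcept of concept nd & name
| ARole of name & name & name.

Arguments ARole {nd}.

(* [ran(r) <= C] is imposed directly or through a superrole of [r]. *)
Definition imposes_range {nd : nat} (T : seq (tbox_axiom nd))
    (r : name) (C : concept nd) : Prop :=
  exists2 s, Relations.Relation_Operators.clos_refl_trans name
               (fun r1 r2 => List.In (RoleIncl [:: r1] r2) T) r s
           & List.In (RanR s C) T.

Definition range_restricted {nd : nat} (T : seq (tbox_axiom nd)) : Prop :=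
  forall rs rk s C, List.In (RoleIncl (rcons rs rk) s) T ->
    imposes_range T s C -> imposes_range T rk C.

(* [PD j p fs] is the unary predicate expressed by the concept [p(fs)]. *)
Inductive opred (nd : nat) : Type :=
| PC of name
| PR of name
| PD of 'I_nd & name & seq name.

Arguments PC {nd}.
Arguments PR {nd}.

(* Translation of [C] at the term [t]; the bound variables are numbered from
   [n] on. *)
Fixpoint tr {nd : nat} (t : term) (n : nat) (C : concept nd) : fo (opred nd) :=
  match C with
  | CTop => FTrue
  | CBot => FFalse
  | CNominal a => FEq t (Cst a)
  | CName A => FAtom (PC A) [:: t]
  | CAnd C1 C2 => FAnd (tr t n C1) (tr t n C2)
  | CEx r C1 =>
      FEx n (FAnd (FAtom (PR r) [:: t; Var n]) (tr (Var n) n.+1 C1))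
  | CData j p fs => FAtom (PD j p fs) [:: t]
  end.

(* Left-hand sides of inclusions are translated as rule bodies: existential
   restrictions give free (hence universally quantified) variables, numbered
   from [n] on, which may thus be shared with an annotation.  The second
   component is the next unused variable. *)
Fixpoint tr_body {nd : nat} (t : term) (n : nat) (C : concept nd) :
    fo (opred nd) * nat :=
  match C with
  | CAnd C1 C2 =>
      let: (F1, n1) := tr_body t n C1 in
      let: (F2, n2) := tr_body t n1 C2 in (FAnd F1 F2, n2)
  | CEx r C1 =>
      let: (F1, n1) := tr_body (Var n) n.+1 C1 in
      (FAnd (FAtom (PR r) [:: t; Var n]) F1, n1)
  | C0 => (tr t n C0, n)
  end.

Fixpoint tr_chain {nd : nat} (i : nat) (rs : seq name) : fo (opred nd) :=
  if rs is r :: rs' then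
    FAnd (FAtom (PR r) [:: Var i; Var i.+1]) (tr_chain i.+1 rs')
  else FTrue.

Definition tr_axiom {nd : nat} (ax : tbox_axiom nd) : fo (opred nd) :=
  match ax with
  | GCI C D => let: (F, n) := tr_body (Var 0) 1 C in FImp F (tr (Var 0) n D)
  | RoleIncl rs s =>
      FImp (tr_chain 0 rs) (FAtom (PR s) [:: Var 0; Var (size rs)])
  | DomR r C => FImp (FAtom (PR r) [:: Var 0; Var 1]) (tr (Var 0) 2 C)
  | RanR r C => FImp (FAtom (PR r) [:: Var 0; Var 1]) (tr (Var 1) 2 C)
  end.

Definition tr_assertion {nd : nat} (al : assertion nd) : fo (opred nd) :=
  match al with
  | AConcept C a => tr (Cst a) 0 C
  | ARole r a b => FAtom (PR r) [:: Cst a; Cst b]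
  end.

Inductive elt : Type := Ind of name | Null of nat.

(* [FactF f e v] states that the feature [f] is defined on [e], with value
   [v]; the tagging makes the concrete domains disjoint. *)
Inductive fact (nd : nat) (cds : 'I_nd -> concrete_domain) : Type :=
| FactC of name & elt
| FactR of name & elt & elt
| FactF of name & elt & {j : 'I_nd & cd_carrier (cds j)}.

Definition fact_elts {nd : nat} {cds : 'I_nd -> concrete_domain}
    (f : fact cds) : seq elt :=
  match f with
  | FactC _ e => [:: e]
  | FactR _ e e' => [:: e; e']
  | FactF _ e _ => [:: e]
  end.

Definition database (nd : nat) (cds : 'I_nd -> concrete_domain) : Type :=
  set (fact cds).

Section Databases.
Context {nd : nat} {cds : 'I_nd -> concrete_domain}.
Implicit Types D : database cds.

Definition occurs_in (e : elt) D : Prop :=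
  exists2 f, D f & List.In e (fact_elts f).

Definition is_database (ind : seq name) D : Prop :=
  (forall c, occurs_in (Ind c) D -> c \in ind) /\
  (forall f e v v', D (FactF f e v) -> D (FactF f e v') -> v = v').

(* Quantifiers range over the individuals and the nulls occurring in [D]. *)
Definition db_dom (ind : seq name) D (e : elt) : Prop :=
  match e with Ind c => c \in ind | Null _ => occurs_in e D end.

Definition db_itp D (p : opred nd) (es : seq elt) : Prop :=
  match p, es with
  | PC A, [:: e] => D (FactC cds A e)
  | PR r, [:: e; e'] => D (FactR cds r e e')
  | PD j q fs, [:: e] =>
      exists2 vs : seq (cd_carrier (cds j)),
        List.Forall2 (fun f v => D (FactF f e (existT _ j v))) fs vs
      & cd_holds q vs
  | _, _ => False
  end.

Definition db_models (ind : seq name) D (theta : subst) (F : fo (opred nd)) :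
    Prop :=
  sat_inst (db_dom ind D) Ind (db_itp D) theta F.

End Databases.

(* The predicate symbols are ['I_m], with arities [ar]. *)
Definition mln (R : Type) (m : nat) : Type := seq (fo 'I_m * R).

Definition mln_wf {R : Type} {m : nat} (ar : 'I_m -> nat) (M : mln R m) :
    Prop :=
  List.NoDup M /\
  forall Fw p ts, List.In Fw M -> List.In (p, ts) (fo_atoms Fw.1) ->
    size ts = ar p.

Definition is_cmln {R : Type} {m : nat} (M : mln R m) : Prop :=
  forall Fw, List.In Fw M -> conj_of_atoms Fw.1.

Definition matom (m : nat) : Type := ('I_m * seq term)%type.

Definition asubst {m : nat} (theta : subst) (A : matom m) : matom m :=
  (A.1, map (tsubst theta) A.2).

(* The random variables: ground atoms over the constants [delta]. *)
Definition rvar {m : nat} (ar : 'I_m -> nat) (delta : seq name) : finType :=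
  {p : 'I_m & (ar p).-tuple (seq_sub delta)}.

Definition world {m : nat} (ar : 'I_m -> nat) (delta : seq name) : finType :=
  {ffun rvar ar delta -> bool}.

Definition annot (m : nat) : Type := seq (matom m * bool).

Section Worlds.
Context {m : nat} {ar : 'I_m -> nat} {delta : seq name}.
Implicit Types x w : world ar delta.

Definition rvar_atom (X : rvar ar delta) : matom m :=
  (tag X, [seq Cst (ssval c) | c <- tagged X]).

Definition world_itp x (p : 'I_m) (cs : seq name) : Prop :=
  exists2 X : rvar ar delta, rvar_atom X = (p, map Cst cs) & x X.

(* Variables outside [fv] are irrelevant and sent to a dummy name. *)
Definition ground_env {fv : seq nat} (g : {ffun seq_sub fv -> seq_sub delta}) :
    nat -> name :=
  fun v => if insub v is Some u then ssval (g u) else [::].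

(* A ground instance of [F] is an assignment of constants to its free
   variables. *)
Definition n_true (F : fo 'I_m) x : nat :=
  #|[pred g : {ffun seq_sub (fo_fv F) -> seq_sub delta} |
      `[< sat (fun c => c \in delta) id (world_itp x) (ground_env g) F >]]|.

Local Open Scope ring_scope.

Definition mln_weight {R : realType} (M : mln R m) x : R :=
  expR (\sum_(Fw <- M) Fw.2 * (n_true Fw.1 x)%:R).

Definition mln_Z {R : realType} (M : mln R m) : R :=
  \sum_(x : world ar delta) mln_weight M x.

Definition mln_prob {R : realType} (M : mln R m) x : R :=
  mln_weight M x / mln_Z M.

Definition world_annot w : annot m := [seq (rvar_atom X, w X) | X : rvar ar delta].

Definition instantiates (theta : subst) (lambda : annot m) w : Prop :=
  forall Vx, Vx \in lambda ->
    exists2 X : rvar ar delta, asubst theta Vx.1 = rvar_atom X & w X = Vx.2.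

(* [theta] unifies the atoms of [lambda] with random variables having the
   prescribed values in [w], and is a most general such unifier. *)
Definition is_mgu (theta : subst) (lambda : annot m) w : Prop :=
  instantiates theta lambda w /\
  forall sigma : subst,
    (forall Vx, Vx \in lambda -> asubst sigma Vx.1 = asubst theta Vx.1) ->
    exists tau : subst, forall v, sigma v = tsubst tau (theta v).

End Worlds.

Definition annot_wf {m : nat} (ar : 'I_m -> nat) (cs : seq name)
    (lambda : annot m) : Prop :=
  (forall Vx, Vx \in lambda -> size Vx.1.2 = ar Vx.1.1 /\
     {subset flatten (map term_csts Vx.1.2) <= cs}) /\
  (forall Vx Vy, Vx \in lambda -> Vy \in lambda -> Vx <> Vy ->
     ~ exists theta, asubst theta Vx.1 = asubst theta Vy.1).

Definition tbox (nd m : nat) : Type := seq (tbox_axiom nd * annot m).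
Definition abox (nd m : nat) : Type := seq (assertion nd * annot m).

Definition onto (nd m : nat) : Type := seq (fo (opred nd) * annot m).

Definition mk_onto {nd m : nat} (T : tbox nd m) (A : abox nd m) : onto nd m :=
  [seq (tr_axiom al.1, al.2) | al <- T] ++
  [seq (tr_assertion al.1, al.2) | al <- A].

(* The constants of [delta] may be substituted into ontology formulas, so
   databases are over the individuals together with [delta]. *)
Definition interp {nd m : nat} (cds : 'I_nd -> concrete_domain)
    (ar : 'I_m -> nat) (delta : seq name) : Type :=
  (database cds * world ar delta)%type.

Section ProbInterp.
Context {nd m : nat} {cds : 'I_nd -> concrete_domain} {ar : 'I_m -> nat}
  {ind delta : seq name}.

Definition satisfies (I : interp cds ar delta) (Fl : fo (opred nd) * annot m) :
    Prop :=
  forall theta : subst, is_mgu theta Fl.2 I.2 ->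
    db_models (ind ++ delta) I.1 theta Fl.1.

Local Open Scope ring_scope.
Local Open Scope classical_set_scope.

Record is_prob_interp {R : realType} (Pr : interp cds ar delta -> R) : Prop :=
  IsProbInterp {
  pi_ge0 : forall I, 0 <= Pr I;
  pi_db : forall I, Pr I != 0 -> is_database (ind ++ delta) I.1;
  pi_fin : finite_set [set I | Pr I != 0];
  pi_sum1 : \sum_(I \in setT) Pr I = 1
}.

Definition prob {R : realType} (Pr : interp cds ar delta -> R)
    (Fl : fo (opred nd) * annot m) : R :=
  \sum_(I \in [set I | satisfies I Fl]) Pr I.

Definition is_model {R : realType} (O : onto nd m) (M : mln R m)
    (Pr : interp cds ar delta -> R) : Prop :=
  [/\ is_prob_interp Pr,
      forall Fl, List.In Fl O -> prob Pr Fl = 1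
    & forall w : world ar delta,
        1 - prob Pr (FFalse, world_annot w) = mln_prob M w].

End ProbInterp.

Inductive query : Type := QConcept of name & name | QRole of name & name & name.

Definition query_pred {nd : nat} (a : query) : opred nd :=
  match a with QConcept A _ => PC A | QRole r _ _ => PR r end.

Definition query_inds (a : query) : seq name :=
  match a with QConcept _ c => [:: c] | QRole _ c d => [:: c; d] end.

Definition query_fo {nd : nat} (a : query) : fo (opred nd) :=
  FAtom (query_pred a) (map Cst (query_inds a)).

(* The infimum is taken in the extended reals: it is [+oo], hence above every
   threshold, when the ontology has no model. *)
Definition tight_prob {R : realType} {nd m : nat}
    (cds : 'I_nd -> concrete_domain) (ar : 'I_m -> nat)
    (ind delta : seq name) (O : onto nd m) (M : mln R m) (a : query) : \bar R :=
  ereal_inf [set (prob (ind := ind) Pr (query_fo a, [::]))%:E | Pr in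
    [set Pr : interp cds ar delta -> R | is_model (ind := ind) O M Pr]]%classic.

(* What is not fixed: the individuals, the MLN constants, the ABox, the query
   and the threshold. *)
Record instance (nd m : nat) : Type := Instance {
  i_ind : seq name;
  i_delta : seq name;
  i_abox : abox nd m;
  i_query : query;
  i_thr : rat
}.

Record instance_wf {R : realType} {nd m : nat}
    (cds : 'I_nd -> concrete_domain) (ar : 'I_m -> nat) (M : mln R m)
    (T : tbox nd m) (i : instance nd m) : Prop := InstanceWf {
  wf_mln : forall Fw, List.In Fw M -> {subset fo_csts Fw.1 <= i_delta i};
  wf_ind : forall Fl, List.In Fl (mk_onto T (i_abox i)) ->
    {subset fo_csts Fl.1 <= i_ind i};
  wf_data : forall Fl j p fs ts, List.In Fl (mk_onto T (i_abox i)) ->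
    List.In (PD j p fs, ts) (fo_atoms Fl.1) ->
    cd_arity (cds j) p = Some (size fs);
  wf_annot : forall Fl, List.In Fl (mk_onto T (i_abox i)) ->
    annot_wf ar (i_ind i ++ i_delta i) Fl.2;
  wf_query_inds : {subset query_inds (i_query i) <= i_ind i};
  wf_query_pred : exists Fl ts, List.In Fl (mk_onto T (i_abox i)) /\
    List.In (query_pred (i_query i), ts) (fo_atoms Fl.1)
}.

Notation stree := (GenTree.tree (seq bool)).
Notation SLeaf := GenTree.Leaf.
Notation SNode := GenTree.Node.

(* Binary representation, least significant bit first. *)
Definition bits (n : nat) : seq bool :=
  mkseq (fun i => odd (n %/ 2 ^ i)) (trunc_log 2 n).+1.

Definition tree_nat (n : nat) : stree := SLeaf (bits n).

Definition tree_seq {T : Type} (f : T -> stree) (s : seq T) : stree :=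
  SNode 0 (map f s).

Definition tree_names (s : seq name) : stree := tree_seq (@SLeaf (seq bool)) s.

Definition tree_term (t : term) : stree :=
  match t with
  | inl v => SNode 0 [:: tree_nat v]
  | inr c => SNode 1 [:: SLeaf c]
  end.

Fixpoint tree_concept {nd : nat} (C : concept nd) : stree :=
  match C with
  | CTop => SNode 0 [::]
  | CBot => SNode 1 [::]
  | CNominal a => SNode 2 [:: SLeaf a]
  | CName A => SNode 3 [:: SLeaf A]
  | CAnd C1 C2 => SNode 4 [:: tree_concept C1; tree_concept C2]
  | CEx r C1 => SNode 5 [:: SLeaf r; tree_concept C1]
  | CData j p fs => SNode 6 [:: tree_nat j; SLeaf p; tree_names fs]
  end.

Definition tree_assertion {nd : nat} (al : assertion nd) : stree :=
  match al with
  | AConcept C a => SNode 0 [:: tree_concept C; SLeaf a]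
  | ARole r a b => SNode 1 [:: SLeaf r; SLeaf a; SLeaf b]
  end.

Definition tree_lit {m : nat} (Vx : matom m * bool) : stree :=
  SNode Vx.2 [:: tree_nat Vx.1.1; tree_seq tree_term Vx.1.2].

Definition tree_annotated {nd m : nat} (al : assertion nd * annot m) : stree :=
  SNode 0 [:: tree_assertion al.1; tree_seq tree_lit al.2].

Definition tree_query (a : query) : stree :=
  match a with
  | QConcept A c => SNode 0 [:: SLeaf A; SLeaf c]
  | QRole r c d => SNode 1 [:: SLeaf r; SLeaf c; SLeaf d]
  end.

Definition tree_rat (q : rat) : stree :=
  SNode (numq q < 0)%R [:: tree_nat `|numq q|; tree_nat `|denq q|].

Definition tree_instance {nd m : nat} (i : instance nd m) : stree :=
  SNode 0 [:: tree_names (i_ind i); tree_names (i_delta i);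
              tree_seq tree_annotated (i_abox i); tree_query (i_query i);
              tree_rat (i_thr i)].

Definition code_token (x : nat + seq bool) : seq bool :=
  match x with
  | inl n => false :: rcons (nseq n true) false
  | inr s => true :: rcons (flatten [seq [:: true; b] | b <- s]) false
  end.

Definition encode {nd m : nat} (i : instance nd m) : seq bool :=
  flatten (map code_token (GenTree.encode (tree_instance i))).

Lemma bits_inj : injective bits.
Proof.
have H k : forall n n', n < 2 ^ k -> n' < 2 ^ k ->
    (forall i, i < k -> odd (n %/ 2 ^ i) = odd (n' %/ 2 ^ i)) -> n = n'.
  elim: k => [|k IHk] n n' ln ln' E.
    by move: ln ln'; rewrite expn0 !ltnS !leqn0 => /eqP-> /eqP->.
  have e0 : odd n = odd n' by have := E 0 isT; rewrite expn0 !divn1.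
  rewrite -(odd_double_half n) -(odd_double_half n') e0; congr (_ + _.*2).
  apply: IHk; rewrite -?divn2 ?ltn_divLR // -?expnSr //.
  by move=> i li; rewrite -!divnMA -expnS; exact: E.
move=> n n' E; have := congr1 size E; rewrite !size_mkseq => -[Es].
apply: (H (trunc_log 2 n).+1); first exact: trunc_log_ltn.
  by rewrite Es; exact: trunc_log_ltn.
move=> i li; have := congr1 (nth false ^~ i) E.
by rewrite !nth_mkseq // -Es.
Qed.

Lemma tree_seq_inj {T : Type} (f : T -> stree) :
  injective f -> injective (tree_seq f).
Proof. by move=> fI s t [] /(inj_map fI). Qed.

Lemma SLeaf_inj : injective (@SLeaf (seq bool)).
Proof. by move=> s t []. Qed.

Lemma tree_nat_inj : injective tree_nat.
Proof. by move=> n p /SLeaf_inj/bits_inj. Qed.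

(* [injection] would otherwise descend into [bits]. *)
Ltac hide_tree_nat := move: tree_nat tree_nat_inj => f fI.

Lemma tree_names_inj : injective tree_names.
Proof. exact: tree_seq_inj SLeaf_inj. Qed.

Lemma tree_term_inj : injective tree_term.
Proof.
rewrite /tree_term; hide_tree_nat.
by move=> [v|c] [v'|c'] // [] => [/fI|] ->.
Qed.

Lemma tree_concept_inj nd : injective (@tree_concept nd).
Proof.
elim=> [||a|A|C1 IH1 C2 IH2|r C IH|j p fs] [||a'|A'|C1' C2'|r' C'|j' p' fs'] //=.
- by case=> ->.
- by case=> ->.
- by case=> /IH1-> /IH2->.
- by case=> -> /IH->.
- by hide_tree_nat; case=> /fI/val_inj -> -> /(inj_map SLeaf_inj) ->.
Qed.

Lemma tree_assertion_inj nd : injective (@tree_assertion nd).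
Proof.
move=> [C a|r a b] [C' a'|r' a' b'] //=; first by case=> /tree_concept_inj-> ->.
by case=> -> -> ->.
Qed.

Lemma tree_lit_inj m : injective (@tree_lit m).
Proof.
rewrite /tree_lit; hide_tree_nat.
move=> [[p ts] b] [[p' ts'] b'] [] /= eb /fI/val_inj ->.
by move=> /(inj_map tree_term_inj) ->; case: b b' eb => [] [].
Qed.

Lemma tree_annotated_inj nd m : injective (@tree_annotated nd m).
Proof.
by move=> [a l] [a' l'] [] /= /tree_assertion_inj-> /(inj_map (@tree_lit_inj m)) ->.
Qed.

Lemma tree_query_inj : injective tree_query.
Proof. by move=> [A c|r c d] [A' c'|r' c' d'] //= [] -> -> // ->. Qed.

Lemma tree_rat_inj : injective tree_rat.
Proof.
rewrite /tree_rat; hide_tree_nat => q q' [] es /fI en /fI ed.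
have es' : (numq q < 0)%R = (numq q' < 0)%R by move: es; do 2!case: (_ < _)%R.
rewrite -(divq_num_den q) -(divq_num_den q').
rewrite (intEsign (numq q)) (intEsign (numq q')) es' en.
by rewrite (intEsign (denq q)) (intEsign (denq q')) !ltNge !denq_ge0 ed.
Qed.

Lemma tree_instance_inj nd m : injective (@tree_instance nd m).
Proof.
move=> [I D A a k] [I' D' A' a' k']; rewrite /tree_instance /=.
move: (@tree_annotated_inj nd m) (@tree_query_inj) (@tree_rat_inj).
move: tree_annotated tree_query tree_rat => g1 g2 g3 I1 I2 I3 [].
move=> /(inj_map SLeaf_inj)-> /(inj_map SLeaf_inj)->.
by move=> /(inj_map I1)-> /I2-> /I3->.
Qed.

Lemma code_tokens_inj : injective (fun s => flatten (map code_token s)).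
Proof.
have Hn n n' (u u' : seq bool) :
    rcons (nseq n true) false ++ u = rcons (nseq n' true) false ++ u' ->
    n = n' /\ u = u'.
  by elim: n n' => [|n IH] [|n'] //= [] => [->//|/IH[-> ->]].
have Hs (s s' u u' : seq bool) :
    rcons (flatten [seq [:: true; b] | b <- s]) false ++ u =
    rcons (flatten [seq [:: true; b] | b <- s']) false ++ u' ->
    s = s' /\ u = u'.
  by elim: s s' => [|b s IH] [|b' s'] //= [] => [->//|-> /IH[-> ->]].
elim=> [|[n|s] l IH] [|[n'|s'] l'] //= [].
  by move=> /Hn[-> /IH->].
by move=> /Hs[-> /IH->].
Qed.

(* The decision problem below thus depends only on the instance. *)
Lemma encode_inj nd m : injective (@encode nd m).
Proof.
move=> i i' /code_tokens_inj E; apply: tree_instance_inj.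
exact: (pcan_inj (@GenTree.codeK _)) E.
Qed.

(* The MLN formulas [M] (with their weights) and the TBox [T] are fixed, as are
   the predicates and the concrete domains. *)
Definition data_problem {R : realType} {nd m : nat}
    (cds : 'I_nd -> concrete_domain) (ar : 'I_m -> nat) (M : mln R m)
    (T : tbox nd m) : seq bool -> Prop :=
  fun u => exists i : instance nd m,
    [/\ encode i = u, instance_wf cds ar M T i
      & ((ratr (i_thr i))%:E <=
           tight_prob cds ar (i_ind i) (i_delta i) (mk_onto T (i_abox i)) M
             (i_query i))%E].

(* [None] is the blank, [Some (inl b)] a bit, [Some (inr e)] a work symbol. *)
Definition symbol (E : finType) : finType := option (bool + E).

Inductive move : Type := MoveL | MoveR | Stay.

(* A machine has [tm_tapes.+1] two-way infinite tapes and two transition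
   functions, indexed by the outcome of a coin flip. *)
Record tm : Type := TM {
  tm_tapes : nat;
  tm_work : finType;
  tm_state : finType;
  tm_start : tm_state;
  tm_halt : pred tm_state;
  tm_accept : pred tm_state;
  tm_step : bool -> tm_state -> {ffun 'I_tm_tapes.+1 -> symbol tm_work} ->
    tm_state * ('I_tm_tapes.+1 -> symbol tm_work * move)
}.

Definition deterministic (M : tm) : Prop :=
  forall q s, tm_step (t := M) true q s = tm_step false q s.

(* The cells left of the head (nearest first), the scanned cell, and the cells
   right of the head (nearest first); all other cells are blank. *)
Definition tape (E : finType) : Type :=
  (seq (symbol E) * symbol E * seq (symbol E))%type.

Definition tape_of_seq {E : finType} (s : seq (symbol E)) : tape E :=
  if s is x :: r then ([::], x, r) else ([::], None, [::]).

Definition write_move {E : finType} (am : symbol E * move) (t : tape E) :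
    tape E :=
  let: (l, _, r) := t in
  let: (a, d) := am in
  match d with
  | Stay => (l, a, r)
  | MoveL => if l is x :: l' then (l', x, a :: r) else ([::], None, a :: r)
  | MoveR => if r is x :: r' then (a :: l, x, r') else (a :: l, None, [::])
  end.

Definition config (M : tm) : Type :=
  (tm_state M * ('I_(tm_tapes M).+1 -> tape (tm_work M)))%type.

(* The input is on the first tape, under and to the right of the head. *)
Definition tm_init (M : tm) (u : seq bool) : config M :=
  (tm_start M,
   fun i => tape_of_seq (if i == ord0 then [seq Some (inl b) | b <- u] else [::])).

Definition tm_next {M : tm} (c : config M) (b : bool) : config M :=
  if tm_halt c.1 then c else
  let: (q, act) := tm_step b c.1 [ffun i => (c.2 i).1.2] in
  (q, fun i => write_move (act i) (c.2 i)).

(* Each step consumes one coin, whether or not it affects the transition. *)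
Definition tm_run (M : tm) (u : seq bool) (coins : seq bool) : config M :=
  foldl tm_next (tm_init M u) coins.

(* The output: the bits on the last tape, read from left to right, blanks and
   work symbols being skipped. *)
Definition tm_output {M : tm} (c : config M) : seq bool :=
  let: (l, x, r) := c.2 ord_max in
  pmap (fun a : symbol (tm_work M) => if a is Some (inl b) then Some b else None)
    (rev l ++ x :: r).

Definition language : Type := seq bool -> Prop.

(* Every polynomial in [n] is bounded by some [n ^ d + d]. *)
Definition poly_bound (d n : nat) : nat := n ^ d + d.

Definition coin_prob (t : nat) (E : t.-tuple bool -> bool) : rat :=
  (#|[pred r | E r]|%:R / (2 ^ t)%:R)%R.

Definition error_prob (M : tm) (L : language) (u : seq bool) (t : nat) : rat :=
  coin_prob (fun r : t.-tuple bool => tm_accept (tm_run M u r).1 != `[< L u >]).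

Definition PP (L : language) : Prop :=
  exists (M : tm) (d : nat), forall u : seq bool,
    let t := poly_bound d (size u) in
    (forall r : t.-tuple bool, tm_halt (tm_run M u r).1) /\
    (error_prob M L u t < 1 / 2)%R.

Definition polytime (f : seq bool -> seq bool) : Prop :=
  exists (M : tm) (d : nat), deterministic M /\ forall u : seq bool,
    let c := tm_run M u (nseq (poly_bound d (size u)) false) in
    tm_halt c.1 /\ tm_output c = f u.

Definition PP_hard (L : language) : Prop :=
  forall L' : language, PP L' ->
    exists2 f : seq bool -> seq bool, polytime f & forall u, L' u <-> L (f u).

(* Main.v *)
(* Reduction from an arbitrary PP language, with no MLN formula and no TBox
   axiom, so that the worlds are uniformly distributed.  An ABox of assertions
   A(c) annotated with conjunctions of ground literals is a DNF, and Pr(A(c)) is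
   the probability that this DNF holds.  The random variables describe, one-hot,
   a space-time tableau of the run of a machine for the language, together with
   its coins; the DNF says that the world violates the transition rule somewhere
   or that the run accepts.  It thus fails exactly in the tableaux of the
   rejecting runs, one for each rejecting coin sequence, and A(c) has probability
   at least 1 - 2^-(s+1), with s the number of variables other than coins, if and
   only if at most half of the coin sequences reject.

   Heads are kept at position 0 and the tapes move instead, so that every cell is
   updated by one local rule reading cell 0.  For computability, the instance is
   written by a program made of nested counting loops, and such programs are
   compiled to Turing machines whose tapes are unary counters. *)
Require Import Defs.
From mathcomp Require Import all_boot all_order all_algebra.
From mathcomp Require Import all_classical all_reals all_analysis.
From mathcomp Require Import zify.

Set Implicit Arguments.
Unset Strict Implicit.
Unset Printing Implicit Defensive.

Import Order.TTheory GRing.Theory Num.Theory.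

(** * Composing Turing machines *)

(** The initial and transition terms each end in a literal giving a cell variable the wrong value.
    If no term holds, induction on time therefore pins every cell variable to the value computed
    from the coins. Hence each rejecting sequence of [N] coins extends in exactly one way to the [s]
    cell variables, and the DNF fails with probability [rej / 2 ^ (s + N)], where [rej] counts these
    sequences. This is at most [2 ^ -(s + 1)] iff [2 * rej <= 2 ^ N]; the extra factor 2 is the
    majority test. The strict error bound makes that test exact: inside the language fewer than half
    of the sequences reject, outside it more than half do.

    That the infimum is the probability of the DNF takes two arguments. In every model the world is
    uniformly distributed and the fact holds whenever a term does; conversely, pairing each world
    with its least database is a model that attains the bound.

    A finite window of cells suffices because influence travels one cell per step. Loop programs can
    only count, so names are written in unary, and the threshold is chosen with a regular bit
    pattern. *)

Notation sym := (symbol unit).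
Notation marker := (Some (inr tt) : sym).

Section Machines.
Context {R : nat}.
Local Notation vec A := ('I_R.+2 -> A).
Local Notation tapes := (vec (tape unit)).

(** Tape [ord0] will hold the input, [ord_max] the output, and the [R] tapes between them the
    registers. There is no coin, since only deterministic machines are composed. *)
Record mach : Type := Mach {
  m_state : finType;
  m_start : m_state;
  m_step : m_state -> vec sym -> option m_state * vec (sym * move)
}.

Definition heads (T : tapes) : vec sym := fun i => (T i).1.2.

Definition act_on (a : vec (sym * move)) (T : tapes) : tapes :=
  fun i => write_move (a i) (T i).

Definition stay (s : vec sym) : vec (sym * move) := fun i => (s i, Stay).

Lemma act_stay T : act_on (stay (heads T)) T = T.
Proof. by apply/funext => i; rewrite /act_on /stay /heads; case: (T i) => [[]]. Qed.

(* The machine leaves through [None], so that the number of steps counts the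
   leaving step. *)
Inductive runs (m : mach) : m_state m -> tapes -> nat -> tapes -> Prop :=
| runs_exit q T a :
    m_step q (heads T) = (None, a) -> runs q T 1 (act_on a T)
| runs_step q T a q' k T' :
    m_step q (heads T) = (Some q', a) -> runs q' (act_on a T) k T' ->
    runs q T k.+1 T'.

Definition prim (i : 'I_R.+2) (w : option sym) (d : move) : mach :=
  @Mach unit tt (fun _ s =>
    (None, fun j => if j == i then (odflt (s j) w, d) else (s j, Stay))).

(** The leaving step of [m1] leads directly to the start of [m2], so that running times add
    exactly. *)
Definition mseq (m1 m2 : mach) : mach :=
  @Mach (m_state m1 + m_state m2)%type (inl (m_start m1)) (fun q s =>
    match q with
    | inl q1 => let: (q', a) := m_step q1 s in
        (Some (if q' is Some q2 then inl q2 else inr (m_start m2)), a)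
    | inr q1 => let: (q', a) := m_step q1 s in (omap inr q', a)
    end).

Definition mite (i : 'I_R.+2) (P : pred sym) (m1 m2 : mach) : mach :=
  @Mach (option (m_state m1 + m_state m2)) None (fun q s =>
    match q with
    | None =>
        (Some (Some (if P (s i) then inl (m_start m1) else inr (m_start m2))),
         stay s)
    | Some (inl q1) =>
        let: (q', a) := m_step q1 s in (omap (fun q => Some (inl q)) q', a)
    | Some (inr q1) =>
        let: (q', a) := m_step q1 s in (omap (fun q => Some (inr q)) q', a)
    end).

Definition mwhile (i : 'I_R.+2) (P : pred sym) (m : mach) : mach :=
  @Mach (option (m_state m)) None (fun q s =>
    match q with
    | None => (if P (s i) then Some (Some (m_start m)) else None, stay s)
    | Some q1 => let: (q', a) := m_step q1 s in (Some q', a)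
    end).

Lemma runs_prim i w d T :
  runs (m_start (prim i w d)) T 1
    (fun j => if j == i then write_move (odflt (T j).1.2 w, d) (T j) else T j).
Proof.
rewrite [X in runs _ _ _ X](_ : _ = act_on
  (fun j => if j == i then (odflt (heads T j) w, d) else (heads T j, Stay)) T).
  exact: runs_exit.
apply/funext => j; rewrite /act_on /heads; case: ifP => // _.
by case: (T j) => [[]].
Qed.

Lemma runs_seq m1 m2 T k1 T1 k2 T2 :
  runs (m_start m1) T k1 T1 -> runs (m_start m2) T1 k2 T2 ->
  runs (m_start (mseq m1 m2)) T (k1 + k2) T2.
Proof.
move=> H1 H2.
have {}H2 : runs (m := mseq m1 m2) (inr (m_start m2)) T1 k2 T2.
  elim: H2 => {T T1 k1 H1 k2 T2} [q T a E|q T a q' k T' E _ IH].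
    by apply: runs_exit; rewrite /= E.
  by apply: runs_step IH; rewrite /= E.
change (runs (m := mseq m1 m2) (inl (m_start m1)) T (k1 + k2) T2).
elim: H1 H2 => {T T1 k1} [q T a E|q T a q' k T' E _ IH] H2.
  by apply: runs_step H2; rewrite /= E.
by apply: runs_step (IH H2); rewrite /= E.
Qed.

Lemma runs_ite i (P : pred sym) m1 m2 T k T' :
  (if P (T i).1.2 then runs (m_start m1) T k T' else runs (m_start m2) T k T') ->
  runs (m_start (mite i P m1 m2)) T k.+1 T'.
Proof.
move=> H; apply: (@runs_step _ _ _ (stay (heads T))); first reflexivity.
rewrite act_stay /heads; case: ifP H => _.
  elim=> {T k T'} [q T a E|q T a q' k T' E _ IH].
    by apply: runs_exit; rewrite /= E.
  by apply: runs_step IH; rewrite /= E.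
elim=> {T k T'} [q T a E|q T a q' k T' E _ IH].
  by apply: runs_exit; rewrite /= E.
by apply: runs_step IH; rewrite /= E.
Qed.

Lemma runs_while_stop i (P : pred sym) m T :
  ~~ P (T i).1.2 -> runs (m_start (mwhile i P m)) T 1 T.
Proof.
move=> nP; rewrite -[X in runs _ _ _ X]act_stay; apply: runs_exit.
by rewrite /= /heads (negPf nP).
Qed.

Lemma runs_while_step i (P : pred sym) m T k1 T1 k2 T2 :
  P (T i).1.2 -> runs (m_start m) T k1 T1 ->
  runs (m_start (mwhile i P m)) T1 k2 T2 ->
  runs (m_start (mwhile i P m)) T (k1 + k2).+1 T2.
Proof.
move=> HP H1 H2; apply: (@runs_step (mwhile i P m) None T (stay (heads T)) (Some (m_start m))).
  by rewrite /= /heads HP.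
rewrite act_stay.
elim: H1 H2 {HP} => {T T1 k1} [q T a E|q T a q' k T' E _ IH] H2.
  by apply: runs_step H2; rewrite /= E.
by apply: runs_step (IH H2); rewrite /= E.
Qed.

Definition tm_of (m : mach) : tm :=
  @TM R.+1 unit (option (m_state m)) (Some (m_start m)) (fun q => ~~ q)
    (fun _ => false) (fun _ q s =>
      if q is Some q1 then m_step q1 s else (None, stay s)).

Lemma tm_of_runs m q T k T' : runs (m := m) q T k T' ->
  foldl (@tm_next (tm_of m)) (Some q, T) (nseq k false) = (None, T').
Proof.
have E T0 : [ffun i => (T0 i).1.2] = heads T0 :> vec sym.
  by apply/funext => i; rewrite ffunE.
elim=> {q T k T'} [q T a e|q T a q' k T' e _ IH] /=; rewrite /tm_next /= E e //.
Qed.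

(** In [polytime] a machine is run for a prescribed polynomial number of steps; this pads a run that
    leaves earlier. *)
Lemma tm_of_halted m T k :
  foldl (@tm_next (tm_of m)) (None, T) (nseq k false) = (None, T).
Proof. by elim: k. Qed.

End Machines.

Arguments mach : clear implicits.

(** * Registers on tapes *)

(* A register holding [v] is a tape with the marker on its initial cell and
   with the head [v] cells to the right of it. *)
Definition reg_tape (v : nat) (t : tape unit) : Prop :=
  exists k, t = if v is v'.+1 then (rcons (nseq v' None) marker, None, nseq k None)
                else ([::], marker, nseq k None).

(** Moving right past the end of the list appends a blank and moving back does not remove it, so the
    tape is known only up to the number [k] of trailing blanks. The same holds for [reg_tape]. *)
Definition in_tape (u : seq bool) (x : nat) (t : tape unit) : Prop :=
  exists k, let s := [seq Some (inl b) | b <- u] ++ nseq k (None : sym) in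
    x < size s /\ t = (rev (take x s), nth None s x, drop x.+1 s).

Definition out_tape (o : seq bool) : tape unit :=
  (rev [seq Some (inl b) | b <- o], None, [::]).

Lemma reg_tape_head v t : reg_tape v t -> (t.1.2 == marker) = (v == 0).
Proof. by case=> k ->; case: v. Qed.

Lemma onth_Some {T : Type} (x0 : T) s n :
  n < size s -> onth s n = Some (nth x0 s n).
Proof. by move=> lt; rewrite onthE (nth_map x0). Qed.

Lemma in_tape_head u x t : in_tape u x t ->
  t.1.2 = omap inl (onth u x) :> sym.
Proof.
case=> k [_ ->] /=; rewrite nth_cat size_map; case: ltnP => xu.
  by rewrite (nth_map false) // (onth_Some false).
by rewrite nth_nseq if_same onth_default.
Qed.

Lemma reg_tape_inc v t : reg_tape v t ->
  reg_tape v.+1 (write_move (t.1.2, MoveR) t).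
Proof.
case=> k ->; case: v => [|v] /=.
  by case: k => [|k]; [exists 0 | exists k].
case: k => [|k]; [exists 0 | exists k] => //.
Qed.

Lemma reg_tape_dec v t : reg_tape v.+1 t ->
  reg_tape v (write_move (t.1.2, MoveL) t).
Proof. by case=> k ->; exists k.+1; case: v. Qed.

Lemma in_tape_right u x t : in_tape u x t ->
  in_tape u x.+1 (write_move (t.1.2, MoveR) t).
Proof.
case=> k [xs ->] /=.
set s := _ ++ _ in xs *.
have [lt|ge] := ltnP x.+1 (size s).
  exists k; rewrite -/s; split=> //.
  rewrite (drop_nth None lt) (take_nth None) ?rev_rcons //.
exists k.+1; cbv zeta; have -> : [seq Some (inl b) | b <- u] ++ nseq k.+1 (None : sym) = rcons s None.
  by rewrite /s -addn1 nseqD catA cats1.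
have ex : x.+1 = size s by apply/eqP; rewrite eqn_leq xs ge.
rewrite size_rcons drop_oversize ?ex //; split=> //.
rewrite drop_oversize ?size_rcons // nth_rcons ltnn eqxx.
rewrite -cats1 take_size_cat //; congr (_, _, _).
by rewrite -rev_rcons -take_nth // ex take_size.
Qed.

Lemma in_tape_left u x t : in_tape u x.+1 t ->
  in_tape u x (write_move (t.1.2, MoveL) t).
Proof.
case=> k [xs ->] /=; exists k.
set s := _ ++ _ in xs *; split; first exact: ltnW.
by rewrite (take_nth None) ?rev_rcons ?(ltnW xs) // (drop_nth None xs).
Qed.

Record memory : Type := Memory { m_pos : nat; m_reg : nat -> nat; m_out : seq bool }.

Section Registers.
Context {R : nat} (u : seq bool).
Local Notation tapes := ('I_R.+2 -> tape unit).

Definition rg (k : nat) : 'I_R.+2 := inord k.+1.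

Lemma rg_inj k l : k < R -> l < R -> (rg k == rg l) = (k == l).
Proof.
move=> kR lR; apply/eqP/eqP => [|-> //] /(congr1 val) /=.
by rewrite !inordK ?ltnS ?(ltnW kR) ?(ltnW lR) // => -[].
Qed.

Lemma rg_ord0 k : k < R -> (rg k == ord0) = false.
Proof. by move=> kR; apply/negP => /eqP/(congr1 val) /=; rewrite inordK ?ltnS ?(ltnW kR). Qed.

Lemma rg_ord_max k : k < R -> (rg k == ord_max) = false.
Proof.
move=> kR; apply/negP => /eqP/(congr1 val) /=; rewrite inordK ?ltnS ?(ltnW kR) //.
by move=> [] kE; rewrite kE ltnn in kR.
Qed.

Definition represents (a : memory) (T : tapes) : Prop :=
  [/\ in_tape u (m_pos a) (T ord0),
      forall k, k < R -> reg_tape (m_reg a k) (T (rg k))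
    & T ord_max = out_tape (m_out a)].

Definition does (m : mach R) (a : memory) (c : nat) (b : memory) : Prop :=
  forall T, represents a T -> exists2 T', runs (m_start m) T c T' & represents b T'.

Definition inc (k : nat) : mach R := prim (rg k) None MoveR.
Definition dec (k : nat) : mach R := prim (rg k) None MoveL.
Definition out (b : bool) : mach R := prim ord_max (Some (Some (inl b))) MoveR.
Definition go_right : mach R := prim ord0 None MoveR.
Definition go_left : mach R := prim ord0 None MoveL.
Definition skip : mach R := prim ord0 None Stay.
Definition if0 (k : nat) : mach R -> mach R -> mach R :=
  mite (rg k) (pred1 marker).
Definition while0 (k : nat) : mach R -> mach R :=
  mwhile (rg k) (predC1 marker).
Definition ifblank : mach R -> mach R -> mach R := mite ord0 (pred1 None).
Definition ifone : mach R -> mach R -> mach R :=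
  mite ord0 (pred1 (Some (inl true))).
Definition whilebit : mach R -> mach R := mwhile ord0 (predC1 None).

Lemma does_inc k x r o : k < R ->
  does (inc k) (Memory x r o) 1 (Memory x (upd r k (r k).+1) o).
Proof.
move=> kR T [/= T0 Tr To]; eexists; first exact: runs_prim.
split=> /=.
- by rewrite eq_sym rg_ord0.
- move=> l lR; rewrite rg_inj // /upd; case: eqP => [->|_]; last exact: Tr.
  by apply: reg_tape_inc; exact: Tr.
- by rewrite eq_sym rg_ord_max.
Qed.

Lemma does_dec k x r o : k < R -> 0 < r k ->
  does (dec k) (Memory x r o) 1 (Memory x (upd r k (r k).-1) o).
Proof.
move=> kR r0 T [/= T0 Tr To]; eexists; first exact: runs_prim.
split=> /=.
- by rewrite eq_sym rg_ord0.
- move=> l lR; rewrite rg_inj // /upd; case: eqP => [->|_]; last exact: Tr.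
  by apply: reg_tape_dec; rewrite prednK //; exact: Tr.
- by rewrite eq_sym rg_ord_max.
Qed.

Lemma does_out b x r o :
  does (out b) (Memory x r o) 1 (Memory x r (rcons o b)).
Proof.
move=> T [/= T0 Tr To]; eexists; first exact: runs_prim.
split=> //=.
- by move=> l lR; rewrite rg_ord_max //; exact: Tr.
- by rewrite eqxx To /out_tape /= map_rcons rev_rcons.
Qed.

Lemma does_right x r o : does go_right (Memory x r o) 1 (Memory x.+1 r o).
Proof.
move=> T [/= T0 Tr To]; eexists; first exact: runs_prim.
split=> //=.
- exact: in_tape_right.
- by move=> l lR; rewrite rg_ord0 //; exact: Tr.
Qed.

Lemma does_left x r o : does go_left (Memory x.+1 r o) 1 (Memory x r o).
Proof.
move=> T [/= T0 Tr To]; eexists; first exact: runs_prim.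
split=> //=.
- exact: in_tape_left.
- by move=> l lR; rewrite rg_ord0 //; exact: Tr.
Qed.

Lemma does_skip a : does skip a 1 a.
Proof.
move=> T [T0 Tr To]; eexists; first exact: runs_prim.
split=> //=.
- by case: (T ord0) T0 => [[]].
- by move=> l lR; rewrite rg_ord0 //; exact: Tr.
Qed.

Lemma does_seq m1 m2 a c1 b c2 d :
  does m1 a c1 b -> does m2 b c2 d -> does (mseq m1 m2) a (c1 + c2) d.
Proof.
move=> H1 H2 T /H1[T1 R1] /H2[T2 R2 S2]; exists T2 => //.
exact: runs_seq R1 R2.
Qed.

Lemma does_if0 k m1 m2 a c b : k < R ->
  (if m_reg a k == 0 then does m1 a c b else does m2 a c b) ->
  does (if0 k m1 m2) a c.+1 b.
Proof.
move=> kR H T Ta; have [_ Tr _] := Ta.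
have E := reg_tape_head (Tr k kR).
case: ifP H E => _ H E; have [T' R' S'] := H T Ta; exists T' => //.
  by apply: runs_ite; rewrite /= E.
by apply: runs_ite; rewrite /= E.
Qed.

Lemma does_while0_stop k m a : k < R -> m_reg a k = 0 ->
  does (while0 k m) a 1 a.
Proof.
move=> kR a0 T Ta; exists T => //; apply: runs_while_stop => /=.
by have [_ Tr _] := Ta; rewrite (reg_tape_head (Tr k kR)) a0.
Qed.

Lemma does_while0_step k m a c1 b c2 d : k < R -> m_reg a k != 0 ->
  does m a c1 b -> does (while0 k m) b c2 d ->
  does (while0 k m) a (c1 + c2).+1 d.
Proof.
move=> kR a0 H1 H2 T Ta; have [_ Tr _] := Ta.
have [T1 R1 S1] := H1 T Ta; have [T2 R2 S2] := H2 T1 S1.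
exists T2 => //; apply: runs_while_step R1 R2 => /=.
by rewrite (reg_tape_head (Tr k kR)).
Qed.

Lemma does_ifblank m1 m2 a c b :
  (if m_pos a < size u then does m2 a c b else does m1 a c b) ->
  does (ifblank m1 m2) a c.+1 b.
Proof.
move=> H T Ta; have [T0 _ _] := Ta; have E := in_tape_head T0.
case: ltnP H E => lt H E; have [T' R' S'] := H T Ta; exists T' => //;
  apply: runs_ite; rewrite /= E.
  by rewrite (onth_Some false).
by rewrite onth_default.
Qed.

Lemma does_ifone m1 m2 a c b :
  (if nth false u (m_pos a) then does m1 a c b else does m2 a c b) ->
  does (ifone m1 m2) a c.+1 b.
Proof.
move=> H T Ta; have [T0 _ _] := Ta; have E := in_tape_head T0.
have {}E : ((T ord0).1.2 == Some (inl true)) = nth false u (m_pos a).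
  rewrite E; have [lt|ge] := ltnP (m_pos a) (size u).
    by rewrite (onth_Some false) //=; case: (nth _ _ _).
  by rewrite onth_default // nth_default.
case: ifP H E => _ H E; have [T' R' S'] := H T Ta; exists T' => //;
  by apply: runs_ite; rewrite /= E.
Qed.

Lemma does_whilebit_stop m a : size u <= m_pos a ->
  does (whilebit m) a 1 a.
Proof.
move=> a0 T Ta; exists T => //; apply: runs_while_stop => /=.
by have [T0 _ _] := Ta; rewrite (in_tape_head T0) onth_default.
Qed.

Lemma does_whilebit_step m a c1 b c2 d : m_pos a < size u ->
  does m a c1 b -> does (whilebit m) b c2 d ->
  does (whilebit m) a (c1 + c2).+1 d.
Proof.
move=> a0 H1 H2 T Ta; have [T0 _ _] := Ta.
have [T1 R1 S1] := H1 T Ta; have [T2 R2 S2] := H2 T1 S1.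
exists T2 => //; apply: runs_while_step R1 R2 => /=.
by rewrite (in_tape_head T0) (onth_Some false).
Qed.

End Registers.

(** * Compiling loop programs *)

(* [GFor] and [GLet] at depth [d] bind the variable [d], the latter to the
   length of the output of its first argument; variable [0] is the input
   length. *)
Inductive gen : Type :=
| GEmit of seq bool
| GSeq of gen & gen
| GFor of nat & gen
| GLet of gen & gen
| GIfZ of nat & gen & gen
| GInp of nat & gen & gen & gen.

Fixpoint emit (u : seq bool) (d : nat) (val : nat -> nat) (p : gen) : seq bool :=
  match p with
  | GEmit s => s
  | GSeq p q => emit u d val p ++ emit u d val q
  | GFor x p =>
      flatten [seq emit u d.+1 (upd val d j) p | j <- iota 0 (val x)]
  | GLet p q => emit u d.+1 (upd val d (size (emit u d.+1 val p))) q
  | GIfZ x p q => if val x == 0 then emit u d val p else emit u d val q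
  | GInp x p p0 p1 =>
      if size u <= val x then emit u d val p
      else if nth false u (val x) then emit u d val p1 else emit u d val p0
  end.

Fixpoint scoped (D d : nat) (p : gen) : bool :=
  match p with
  | GEmit _ => true
  | GSeq p q => scoped D d p && scoped D d q
  | GFor x p => [&& x < d, d < D & scoped D d.+1 p]
  | GLet p q => [&& d < D, scoped D d.+1 p & scoped D d.+1 q]
  | GIfZ x p q => [&& x < d, scoped D d p & scoped D d q]
  | GInp x p q r => [&& x < d, d < D, scoped D d p, scoped D d q & scoped D d r]
  end.

(** For any [B >= 2] that bounds the input length and the variables, [B ^ gen_exp p] will bound both
    running time and output length. The product in the [GLet] case arises because the new variable
    may be as large as the output of [p], so that [q] is bounded in terms of
    [B ^ (gen_exp p).+1]. *)
Fixpoint gen_exp (p : gen) : nat :=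
  match p with
  | GEmit s => size s
  | GSeq p q => (gen_exp p + gen_exp q).+1
  | GFor x p => gen_exp p + 5
  | GLet p q => gen_exp p + (gen_exp p).+1 * gen_exp q + 4
  | GIfZ x p q => (gen_exp p + gen_exp q).+1
  | GInp x p q r => gen_exp p + gen_exp q + gen_exp r + 6
  end.

Lemma leq_expl m n e : m <= n -> m ^ e <= n ^ e.
Proof. by case: e => // e mn; rewrite leq_exp2r. Qed.

Lemma leq_addX B a b : 2 <= B -> B ^ a + B ^ b <= B ^ (a + b).+1.
Proof.
move=> B2; have B0 : 0 < B by exact: ltnW.
rewrite expnS expnD; have : 0 < B ^ a by rewrite expn_gt0 B0.
have : 0 < B ^ b by rewrite expn_gt0 B0.
move: (B ^ a) (B ^ b) => X Y X0 Y0.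
by have := leq_mul B2 (leqnn (X * Y)); nia.
Qed.

Section Compile.
Context (D : nat) (u : seq bool).
Local Notation R := (D.*2).

(** With a target register the emitted bits are only counted; this is how [GLet] measures the output
    of its first argument. *)
Definition put_bit (r : option nat) (b : bool) : mach R :=
  if r is Some k then inc k else out b.

(* Variable [x] lives in register [x.*2]; the odd registers hold the remaining
   number of iterations of a [GFor] and the output of the first part of a
   [GLet]. *)
Fixpoint compile (r : option nat) (d : nat) (p : gen) : mach R :=
  match p with
  | GEmit s => foldr (fun b m => mseq (put_bit r b) m) skip s
  | GSeq p q => mseq (compile r d p) (compile r d q)
  | GFor x p =>
      mseq (while0 x.*2 (mseq (dec x.*2) (inc d.*2)))
     (mseq (while0 d.*2 (mseq (dec d.*2) (mseq (inc x.*2) (inc d.*2.+1))))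
     (mseq (while0 d.*2.+1
              (mseq (dec d.*2.+1) (mseq (compile r d.+1 p) (inc d.*2))))
           (while0 d.*2 (dec d.*2))))
  | GLet p q =>
      mseq (compile (Some d.*2.+1) d.+1 p)
     (mseq (while0 d.*2.+1 (mseq (dec d.*2.+1) (inc d.*2)))
     (mseq (compile r d.+1 q) (while0 d.*2 (dec d.*2))))
  | GIfZ x p q => if0 x.*2 (compile r d p) (compile r d q)
  | GInp x p p0 p1 =>
      let back := while0 d.*2 (mseq (dec d.*2) (mseq (inc x.*2) go_left)) in
      mseq (while0 x.*2 (mseq (dec x.*2) (mseq (inc d.*2) go_right)))
        (ifblank (mseq back (compile r d p))
          (ifone (mseq back (compile r d p1)) (mseq back (compile r d p0))))
  end.

(** Only an upper bound on the time is kept, so that branches and loop rounds of different durations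
    share one bound. *)
Definition reaches (m : mach R) (a : memory) (C : nat) (b : memory) : Prop :=
  exists2 c, c <= C & does u m a c b.

Lemma reaches_seq m1 m2 a C1 b C2 d :
  reaches m1 a C1 b -> reaches m2 b C2 d -> reaches (mseq m1 m2) a (C1 + C2) d.
Proof.
move=> [c1 l1 H1] [c2 l2 H2]; exists (c1 + c2); first exact: leq_add.
exact: does_seq H1 H2.
Qed.

Lemma reaches_leq m a C C' b : C <= C' -> reaches m a C b -> reaches m a C' b.
Proof. by move=> le [c lc H]; exists c => //; exact: leq_trans le. Qed.

Lemma reaches_while0 k m (f : nat -> memory) v C : k < R ->
  (forall i, i <= v -> m_reg (f i) k = v - i) ->
  (forall i, i < v -> reaches m (f i) C (f i.+1)) ->
  reaches (while0 k m) (f 0) (v * C.+1).+1 (f v).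
Proof.
move=> kR; elim: v f => [|v IH] f Hk Hf.
  by exists 1 => //; apply: does_while0_stop => //; rewrite Hk.
have [c lc Hc] := Hf 0 isT.
have [||c' lc' Hc'] := IH (fun i => f i.+1).
- by move=> i iv; rewrite Hk // subSS.
- by move=> i iv; exact: Hf.
exists (c + c').+1; first by lia.
by apply: does_while0_step Hc Hc' => //; rewrite Hk.
Qed.

Lemma reaches_inc k x r o r' : k < R -> r' = upd r k (r k).+1 ->
  reaches (inc k) (Memory x r o) 1 (Memory x r' o).
Proof. by move=> kR ->; exists 1 => //; exact: does_inc. Qed.

Lemma reaches_dec k x r o r' : k < R -> 0 < r k -> r' = upd r k (r k).-1 ->
  reaches (dec k) (Memory x r o) 1 (Memory x r' o).
Proof. by move=> kR r0 ->; exists 1 => //; exact: does_dec. Qed.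

Ltac updeq := apply/funext => ?; rewrite /upd;
  repeat (case: eqP => ?); try lia; subst; try lia.


Lemma reaches_clear k x r o r' : k < R -> r' = upd r k 0 ->
  reaches (while0 k (dec k)) (Memory x r o) (r k * 2).+1 (Memory x r' o).
Proof.
move=> kR ->; pose f i := Memory x (upd r k (r k - i)) o.
have -> : Memory x r o = f 0 by congr Memory; updeq.
have -> : Memory x (upd r k 0) o = f (r k) by congr Memory; updeq.
apply: reaches_while0 => // [i _|i iv] /=; first by rewrite /upd eqxx.
by apply: reaches_dec => //; [rewrite /upd eqxx; lia | updeq].
Qed.

Lemma reaches_move k l x r o r' : k < R -> l < R -> k != l ->
  r' = upd (upd r k 0) l (r l + r k) ->
  reaches (while0 k (mseq (dec k) (inc l)))
    (Memory x r o) (r k * 3).+1 (Memory x r' o).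
Proof.
move=> kR lR /eqP kl ->.
pose f i := Memory x (upd (upd r k (r k - i)) l (r l + i)) o.
have -> : Memory x r o = f 0 by congr Memory; updeq.
have -> : Memory x (upd (upd r k 0) l (r l + r k)) o = f (r k).
  by congr Memory; updeq.
apply: reaches_while0 => // [i _|i iv] /=; first by rewrite /upd; repeat case: eqP.
apply: (@reaches_seq _ _ _ 1 (Memory x (upd (upd r k (r k - i.+1)) l (r l + i)) o)).
  by apply: reaches_dec => //; [rewrite /upd; repeat case: eqP; lia | updeq].
by apply: reaches_inc => //; updeq.
Qed.

Lemma reaches_copy k l l' x r o r' : k < R -> l < R -> l' < R ->
  k != l -> k != l' -> l != l' ->
  r' = upd (upd (upd r k 0) l (r l + r k)) l' (r l' + r k) ->
  reaches (while0 k (mseq (dec k) (mseq (inc l) (inc l'))))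
    (Memory x r o) (r k * 4).+1 (Memory x r' o).
Proof.
move=> kR lR lR' /eqP kl /eqP kl' /eqP ll' ->.
pose g i j m := upd (upd (upd r k (r k - i)) l (r l + j)) l' (r l' + m).
pose f i := Memory x (g i i i) o.
have -> : Memory x r o = f 0 by congr Memory; rewrite /g; updeq.
rewrite (_ : upd (upd (upd r k 0) l _) _ _ = g (r k) (r k) (r k)); last first.
  by rewrite /g; updeq.
apply: (reaches_while0 (f := f)) => // [i _|i iv] /=.
  by rewrite /g /upd; repeat case: eqP.
apply: (@reaches_seq _ _ _ 1 (Memory x (g i.+1 i i) o)).
  by apply: reaches_dec => //; [rewrite /g /upd; repeat case: eqP; lia | rewrite /g; updeq].
apply: (@reaches_seq _ _ _ 1 (Memory x (g i.+1 i.+1 i) o)).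
  by apply: reaches_inc => //; rewrite /g; updeq.
by apply: reaches_inc => //; rewrite /g; updeq.
Qed.

Lemma reaches_seek k l r o r' : k < R -> l < R -> k != l ->
  r' = upd (upd r k 0) l (r l + r k) ->
  reaches (while0 k (mseq (dec k) (mseq (inc l) go_right)))
    (Memory 0 r o) (r k * 4).+1 (Memory (r k) r' o).
Proof.
move=> kR lR /eqP kl ->.
pose g i j := upd (upd r k (r k - i)) l (r l + j).
pose f i := Memory i (g i i) o.
have -> : Memory 0 r o = f 0 by congr Memory; rewrite /g; updeq.
rewrite (_ : upd (upd r k 0) l _ = g (r k) (r k)); last by rewrite /g; updeq.
apply: (reaches_while0 (f := f)) => // [i _|i iv] /=.
  by rewrite /g /upd; repeat case: eqP.
apply: (@reaches_seq _ _ _ 1 (Memory i (g i.+1 i) o)).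
  by apply: reaches_dec => //; [rewrite /g /upd; repeat case: eqP; lia | rewrite /g; updeq].
apply: (@reaches_seq _ _ _ 1 (Memory i (g i.+1 i.+1) o)).
  by apply: reaches_inc => //; rewrite /g; updeq.
by exists 1 => //; exact: does_right.
Qed.

Lemma reaches_rewind k l r o r' : k < R -> l < R -> k != l ->
  r' = upd (upd r k 0) l (r l + r k) ->
  reaches (while0 k (mseq (dec k) (mseq (inc l) go_left)))
    (Memory (r k) r o) (r k * 4).+1 (Memory 0 r' o).
Proof.
move=> kR lR /eqP kl ->.
pose g i j := upd (upd r k (r k - i)) l (r l + j).
pose f i := Memory (r k - i) (g i i) o.
have -> : Memory (r k) r o = f 0 by congr Memory; rewrite /g; [lia|updeq].
rewrite (_ : Memory 0 _ o = f (r k)); last by congr Memory; rewrite /g; [lia|updeq].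
apply: (reaches_while0 (f := f)) => // [i _|i iv] /=.
  by rewrite /g /upd; repeat case: eqP.
apply: (@reaches_seq _ _ _ 1 (Memory (r k - i) (g i.+1 i) o)).
  by apply: reaches_dec => //; [rewrite /g /upd; repeat case: eqP; lia | rewrite /g; updeq].
apply: (@reaches_seq _ _ _ 1 (Memory (r k - i) (g i.+1 i.+1) o)).
  by apply: reaches_inc => //; rewrite /g; updeq.
by exists 1 => //; rewrite -(subnSK iv); exact: does_left.
Qed.

Definition put (s : option nat) (r : nat -> nat) (o w : seq bool) : memory :=
  if s is Some k then Memory 0 (upd r k (r k + size w)) o
  else Memory 0 r (o ++ w).

Lemma put_cat s r o w w' : put s r o (w ++ w') =
  let a := put s r o w in put s (m_reg a) (m_out a) w'.
Proof.
case: s => [k|] /=; last by rewrite catA.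
by congr Memory; rewrite size_cat; updeq.
Qed.

Lemma reaches_emit s r o w : (if s is Some k then k < R else true) ->
  reaches (foldr (fun b m => mseq (put_bit s b) m) skip w)
    (Memory 0 r o) (size w).+1 (put s r o w).
Proof.
move=> ss; elim: w r o => [|b w IH] r o.
  rewrite (_ : put s r o [::] = Memory 0 r o).
    by exists 1 => //; exact: does_skip.
  by case: s {ss} => [k|] /=; [congr Memory; updeq | rewrite cats0].
rewrite -cat1s put_cat /=; apply: (@reaches_seq _ _ _ 1); last exact: IH.
case: s ss {IH} => [k|] /= ss; first by apply: reaches_inc => //; rewrite addn1.
by exists 1 => //; rewrite cats1; exact: does_out.
Qed.

Lemma put_eta s r o w :
  put s r o w = Memory 0 (m_reg (put s r o w)) (m_out (put s r o w)).
Proof. by case: s. Qed.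

Lemma put_reg s r o w k : s <> Some k -> m_reg (put s r o w) k = r k.
Proof. by case: s => //= l; rewrite /upd; case: eqP => // ->. Qed.

Lemma put_upd s r o w k v : s <> Some k ->
  m_reg (put s (upd r k v) o w) = upd (m_reg (put s r o w)) k v.
Proof.
by case: s => //= l kl; updeq; case: kl; congr Some.
Qed.

Lemma put_upd_out s r o w k v : s <> Some k ->
  m_out (put s (upd r k v) o w) = m_out (put s r o w).
Proof. by case: s. Qed.

Lemma put_updE s r o w k v : s <> Some k ->
  put s (upd r k v) o w = Memory 0 (upd (m_reg (put s r o w)) k v)
                                   (m_out (put s r o w)).
Proof. by move=> sk; rewrite [LHS]put_eta put_upd // put_upd_out. Qed.

Lemma put0 s r o : put s r o [::] = Memory 0 r o.
Proof.
by case: s => [k|] /=; [congr Memory; updeq | rewrite cats0].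
Qed.

Lemma reaches_ifblank m1 m2 a C b :
  (if m_pos a < size u then reaches m2 a C b else reaches m1 a C b) ->
  reaches (ifblank m1 m2) a C.+1 b.
Proof.
move=> H; have : exists2 c, c <= C &
    if m_pos a < size u then does u m2 a c b else does u m1 a c b.
  by case: ifP H => _ [c lc Hc]; exists c.
by case=> c lc /does_ifblank Hc; exists c.+1.
Qed.

Lemma reaches_ifone m1 m2 a C b :
  (if nth false u (m_pos a) then reaches m1 a C b else reaches m2 a C b) ->
  reaches (ifone m1 m2) a C.+1 b.
Proof.
move=> H; have : exists2 c, c <= C &
    if nth false u (m_pos a) then does u m1 a c b else does u m2 a c b.
  by case: ifP H => _ [c lc Hc]; exists c.
by case=> c lc /does_ifone Hc; exists c.+1.
Qed.

Lemma reaches_if0 k m1 m2 a C b : k < R ->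
  (if m_reg a k == 0 then reaches m1 a C b else reaches m2 a C b) ->
  reaches (if0 k m1 m2) a C.+1 b.
Proof.
move=> kR H; have : exists2 c, c <= C &
    if m_reg a k == 0 then does u m1 a c b else does u m2 a c b.
  by case: ifP H => _ [c lc Hc]; exists c.
by case=> c lc /(does_if0 kR) Hc; exists c.+1.
Qed.

(** The invariant is that all registers from [d.*2] on are zero, on entry and again on exit, so they
    are free as scratch space. The target register, being odd and below [d.*2], is neither a
    variable nor scratch space. *)
Lemma reaches_compile p d s r o B :
  scoped D d p -> d <= D -> 2 <= B -> size u <= B ->
  (forall k, d.*2 <= k -> r k = 0) -> (forall k, r k.*2 <= B) ->
  (if s is Some k then odd k && (k < d.*2) else true) ->
  let w := emit u d (fun k => r k.*2) p in
  reaches (compile s d p) (Memory 0 r o) (B ^ gen_exp p) (put s r o w) /\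
  size w <= B ^ gen_exp p.
Proof.
elim: p d s r o B => [w|p IHp q IHq|x p IHp|p IHp q IHq|x p IHp q IHq
    |x p IHp q IHq p1 IHp1] d s r o B /=.
- move=> _ dD B2 uB r0 rB ss.
  have lt : (size w).+1 <= B ^ size w.
    by apply: leq_trans (ltn_expl _ (isT : 1 < 2)) _; exact: leq_expl.
  split; last exact: ltnW.
  apply: reaches_leq lt _; apply: reaches_emit; case: s ss => // k /andP[_ ks].
  by apply: leq_trans ks _; rewrite leq_double.
- case/andP=> sp sq dD B2 uB r0 rB ss.
  have [Hp lp] := IHp d s r o B sp dD B2 uB r0 rB ss.
  move: Hp lp; set w := emit u d _ p; set w' := emit u d _ q => Hp lp.
  have evenE k : m_reg (put s r o w) k.*2 = r k.*2.
    rewrite put_reg //; case: s ss {Hp} => // l /andP[ol _] [lk].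
    by rewrite lk odd_double in ol.
  have [|k|Hq lq] := IHq d s (m_reg (put s r o w)) (m_out (put s r o w)) B
    sq dD B2 uB _ _ ss.
  + move=> k dk; rewrite put_reg ?r0 //; case: s ss {Hp evenE} => // l /andP[_ ld] [lk].
    by rewrite lk ltnNge dk in ld.
  + by rewrite evenE.
  + have B0 : 0 < B by exact: leq_trans B2.
    have Bp : 0 < B ^ gen_exp p by rewrite expn_gt0 B0.
    have Bq : 0 < B ^ gen_exp q by rewrite expn_gt0 B0.
    have le : B ^ gen_exp p + B ^ gen_exp q <= B ^ (gen_exp p + gen_exp q).+1.
      exact: leq_addX.
    rewrite (_ : (fun k => _ k.*2) = (fun k => r k.*2)) -/w' in Hq lq; last first.
      by apply/funext => k; exact: evenE.
    split; last by rewrite size_cat; apply: leq_trans le; exact: leq_add.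
    apply: reaches_leq le _; apply: reaches_seq Hp _; rewrite put_eta put_cat /=.
    exact: Hq.
- case/and3P=> xd ltdD sp dD B2 uB r0 rB ss.
  set v := r x.*2; set W := fun i => flatten [seq emit u d.+1
    (upd (fun k => r k.*2) d j) p | j <- iota 0 i].
  have W_S i : W i.+1 = W i ++ emit u d.+1 (upd (fun k => r k.*2) d i) p.
    by rewrite /W -[i.+1]addn1 iotaD map_cat flatten_cat /= cats0.
  pose g a b := upd (upd r d.*2.+1 a) d.*2 b.
  have s1 : s <> Some d.*2.+1.
    by case: s ss => // k /andP[_ kd] [ke]; rewrite ke in kd; lia.
  have s2 : s <> Some d.*2.
    by case: s ss {s1} => // k /andP[_ kd] [ke]; rewrite ke in kd; lia.
  have B0 : 0 < B by exact: leq_trans B2.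
  have Bp : 0 < B ^ gen_exp p by rewrite expn_gt0 B0.
  have step i : i < v ->
      reaches (compile s d.+1 p) (put s (g (v - i.+1) i) o (W i)) (B ^ gen_exp p)
        (put s (g (v - i.+1) i) o (W i.+1)) /\
      size (W i.+1) <= size (W i) + B ^ gen_exp p.
    move=> iv; have vB : v <= B by exact: rB.
    have gE k : g (v - i.+1) i k.*2 = upd (fun k => r k.*2) d i k.
      by rewrite /g /upd; repeat case: eqP; lia.
    have pE k : m_reg (put s (g (v - i.+1) i) o (W i)) k.*2 =
        upd (fun k => r k.*2) d i k.
      rewrite put_reg ?gE //; case: s ss {s1 s2} => // l /andP[ol _] [lk].
      by rewrite lk odd_double in ol.
    have [|k||] := IHp d.+1 s (m_reg (put s (g (v - i.+1) i) o (W i)))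
      (m_out (put s (g (v - i.+1) i) o (W i))) B sp ltdD B2 uB.
    + move=> k dk; rewrite put_reg; last first.
        by case: s ss {s1 s2 pE} => // l /andP[_ ld] [lk]; lia.
      by rewrite /g /upd; repeat (case: eqP => [?|_]); try lia; apply: r0; lia.
    + by rewrite pE /upd; case: eqP => _ //; lia.
    + by case: s ss {s1 s2 pE} => // l /andP[-> ld] /=; lia.
    rewrite (_ : (fun k => _ k.*2) = upd (fun k => r k.*2) d i); last first.
      by apply/funext => k; exact: pE.
    move=> Hp lp; split; last by rewrite W_S size_cat leq_add2l.
    by rewrite W_S put_cat put_eta; exact: Hp.
  have sW i : i <= v -> size (W i) <= i * B ^ gen_exp p.
    elim: i => [//|i IH] iv; have [_ le] := step i iv.
    by apply: leq_trans le _; rewrite mulSn addnC leq_add2l; apply/IH/ltnW.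
  have vB : v <= B by exact: rB.
  split; last first.
    apply: leq_trans (sW v (leqnn _)) _; rewrite addnC expnD.
    by apply: leq_mul => //; apply: leq_trans vB _; rewrite -{1}(expn1 B) leq_pexp2l.
  have xdne : x.*2 != d.*2 by apply/eqP; lia.
  pose C := (v * 3).+1 + ((v * 4).+1 +
    ((v * (1 + (B ^ gen_exp p + 1)).+1).+1 + (v * 2).+1)).
  have le : C <= B ^ (gen_exp p + 5).
    rewrite /C expnD; move: (B ^ gen_exp p) Bp => X X0.
    apply: (@leq_trans (X * (16 * B))).
      by have := leq_mul vB (leqnn X); nia.
    rewrite leq_mul2l; apply/orP; right; rewrite expnSr leq_mul2r; apply/orP; right.
    by apply: leq_trans (leq_expl 4 B2).
  apply: reaches_leq le _; rewrite /C.
  (* Reading a register destroys it: the bound is first moved to [d.*2], then copied back to [x.*2]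
     and into the counter [d.*2.+1]. This leaves [d.*2] at zero, ready to serve as the loop
     index. *)
  apply: reaches_seq.
    by apply: reaches_move => //; rewrite ?ltn_double //; lia.
  rewrite -/v (r0 d.*2) // add0n.
  set r1 := upd _ _ _.
  have E1 : r1 d.*2 = v by rewrite /r1 /upd eqxx.
  rewrite -[X in (X * 4).+1]E1; apply: reaches_seq.
    by apply: reaches_copy => //; lia.
  rewrite (_ : Memory 0 _ o = put s (g (v - 0) 0) o (W 0)); last first.
    rewrite put0; congr Memory; rewrite /g /r1 subn0.
    have e1 := r0 d.*2.+1 (leqnSn _); have e2 := r0 d.*2 (leqnn _).
    have e3 : v = r x.*2 by [].
    by clear E1 r1; clearbody v; apply/funext => k; rewrite /upd; repeat (case: eqP => ?); subst; lia.
  apply: reaches_seq.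
    apply: (reaches_while0 (f := fun i => put s (g (v - i) i) o (W i))) => //; try lia.
      by move=> i iv; rewrite put_reg // /g /upd; repeat case: eqP; lia.
    move=> i iv; apply: (@reaches_seq _ _ _ 1 (put s (g (v - i.+1) i) o (W i))).
      rewrite (put_updE _ _ _ _ s2) (put_updE _ _ _ _ s1).
      rewrite (put_updE _ _ _ _ s2) (put_updE _ _ _ _ s1) /=.
      by apply: reaches_dec; [lia | rewrite /upd; repeat case: eqP; lia | updeq].
    have [Hs _] := step i iv; apply: (reaches_seq Hs).
    rewrite (put_updE _ _ _ _ s2) (put_updE _ _ _ _ s1).
    rewrite (put_updE _ _ _ _ s2) (put_updE _ _ _ _ s1) /=.
    by apply: reaches_inc; [lia | updeq].
  rewrite [put s r o _](_ : _ = Memory 0 (m_reg (put s r o (W v)))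
    (m_out (put s (g 0 v) o (W v)))); last first.
    by rewrite /g put_upd_out // put_upd_out // -put_eta.
  rewrite subnn [put s (g 0 v) o _]put_eta.
  have E2 : m_reg (put s (g 0 v) o (W v)) d.*2 = v.
    by rewrite put_reg // /g /upd eqxx.
  rewrite -[X in (X * 2).+1]E2; apply: reaches_clear; first by lia.
  rewrite /g put_upd // put_upd //; apply/funext => k; rewrite /upd.
  repeat case: eqP => // ?; subst k; rewrite put_reg ?r0 //; lia.
- case/and3P=> ltdD sp sq dD B2 uB r0 rB ss.
  have s2 : s <> Some d.*2.
    by case: s ss => // k /andP[_ kd] [ke]; rewrite ke in kd; lia.
  have e1 := r0 d.*2.+1 (leqnSn _); have e2 := r0 d.*2 (leqnn _).
  have [||] := IHp d.+1 (Some d.*2.+1) r o B sp ltdD B2 uB _ rB.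
  - by move=> k dk; apply: r0; lia.
  - by rewrite /= odd_double /=; lia.
  set w := emit _ _ _ p => Hp lp; set v := size w in lp *.
  set B' := B ^ (gen_exp p).+1.
  have B0 : 0 < B by exact: leq_trans B2.
  have Bp : 0 < B ^ gen_exp p by rewrite expn_gt0 B0.
  have BB' : B <= B' by rewrite -[X in X <= _]expn1 leq_pexp2l.
  have vE : (fun k => upd r d.*2 v k.*2) = upd (fun k => r k.*2) d v.
    by apply/funext => k; rewrite /upd; repeat case: eqP; lia.
  have [||k|||] := IHq d.+1 s (upd r d.*2 v) o B' sq ltdD.
  - exact: leq_trans BB'.
  - exact: leq_trans BB'.
  - by move=> dk; rewrite /upd; case: eqP => [|_]; [lia | apply: r0; lia].
  - move=> k; rewrite /upd; case: eqP => _; last exact: leq_trans BB'.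
    by apply: leq_trans lp _; rewrite leq_pexp2l.
  - by case: s ss {s2} => // l /andP[-> ld] /=; lia.
  rewrite vE -expnM; set w' := emit _ _ _ q => Hq lq.
  have Bq : 0 < B ^ ((gen_exp p).+1 * gen_exp q) by rewrite expn_gt0 B0.
  split; last first.
    by apply: leq_trans lq _; rewrite leq_pexp2l // addnC addnA leq_addl.
  pose C := B ^ gen_exp p + ((v * 3).+1 +
    (B ^ ((gen_exp p).+1 * gen_exp q) + (v * 2).+1)).
  have le : C <= B ^ (gen_exp p + (gen_exp p).+1 * gen_exp q + 4).
    have /= le16 := leq_expl 4 B2; rewrite /C expnD expnD.
    move: Bp Bq lp le16; clear; clearbody v.
    move: (B ^ gen_exp p) (B ^ (_ * _)) (B ^ 4) => X Y Z X0 Y0 vX Z16.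
    by have := leq_mul (leqnn (X * Y)) Z16; nia.
  apply: reaches_leq le _; apply: (reaches_seq Hp); rewrite /=.
  rewrite e1 add0n.
  set r1 := upd r _ v.
  have E1 : r1 d.*2.+1 = v by rewrite /r1 /upd eqxx.
  apply: (@reaches_seq _ _ _ _ (Memory 0 (upd r d.*2 v) o)).
    rewrite -[X in (X * 3).+1]E1; apply: reaches_move; try lia.
    rewrite E1 /r1 /upd; clear Hq Hp; clearbody v; clear E1 r1.
    by apply/funext => k; repeat (case: eqP => ?); subst; lia.
  apply: (reaches_seq Hq); rewrite put_updE //.
  rewrite -[X in (X * 2).+1](_ : upd (m_reg (put s r o w')) d.*2 v d.*2 = v); last first.
    by rewrite /upd eqxx.
  rewrite [X in reaches _ _ _ X]put_eta; apply: reaches_clear; first by lia.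
  apply/funext => k; rewrite {1 2}/upd; case: eqP => // ->.
  by rewrite put_reg.
- case/and3P=> xd sp sq dD B2 uB r0 rB ss.
  have B0 : 0 < B by exact: leq_trans B2.
  have lp : B ^ gen_exp p <= (B ^ (gen_exp p + gen_exp q).+1).-1.
    rewrite -ltnS prednK ?expn_gt0 ?B0 // ltn_exp2l // ltnS; exact: leq_addr.
  have lq : B ^ gen_exp q <= (B ^ (gen_exp p + gen_exp q).+1).-1.
    rewrite -ltnS prednK ?expn_gt0 ?B0 // ltn_exp2l // ltnS; exact: leq_addl.
  have [Hp sizep] := IHp d s r o B sp dD B2 uB r0 rB ss.
  have [Hq sizeq] := IHq d s r o B sq dD B2 uB r0 rB ss.
  split; last first.
    by case: ifP => _; [apply: leq_trans sizep _ | apply: leq_trans sizeq _];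
      rewrite leq_pexp2l // -addSn ?leq_addl // addSn -addnS leq_addr.
  rewrite -(@prednK (B ^ (gen_exp p + gen_exp q).+1)) ?expn_gt0 ?B0 //.
  apply: reaches_if0 => /=; first by lia.
  by case: (r x.*2 == 0); [exact: reaches_leq lp Hp | exact: reaches_leq lq Hq].
- case/and5P=> xd ltdD sp sq sp1 dD B2 uB r0 rB ss.
  have B0 : 0 < B by exact: leq_trans B2.
  have [Hp sizep] := IHp d s r o B sp dD B2 uB r0 rB ss.
  have [Hq sizeq] := IHq d s r o B sq dD B2 uB r0 rB ss.
  have [Hp1 sizep1] := IHp1 d s r o B sp1 dD B2 uB r0 rB ss.
  set e := gen_exp p + gen_exp q + gen_exp p1.
  have lp : B ^ gen_exp p <= B ^ e by rewrite leq_pexp2l // /e -addnA leq_addr.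
  have lq : B ^ gen_exp q <= B ^ e.
    by rewrite leq_pexp2l // /e addnAC leq_addl.
  have lp1 : B ^ gen_exp p1 <= B ^ e by rewrite leq_pexp2l // /e leq_addl.
  have l6 : B ^ e <= B ^ (e + 6) by rewrite leq_pexp2l // leq_addr.
  split; last first.
    apply: leq_trans l6.
    by case: ifP => _; last case: ifP => _;
      [apply: leq_trans sizep _ | apply: leq_trans sizep1 _ | apply: leq_trans sizeq _].
  set v := r x.*2; have vB : v <= B by exact: rB.
  have e2 := r0 d.*2 (leqnn _).
  set r1 := upd (upd r x.*2 0) d.*2 v.
  have E1 : r1 d.*2 = v by rewrite /r1 /upd eqxx.
  (* The scanned bit is remembered only by the branch taken, so each branch rewinds the input head
     itself. *)
  have back m w : reaches m (Memory 0 r o) (B ^ e) w ->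
      reaches (mseq (while0 d.*2 (mseq (dec d.*2) (mseq (inc x.*2) go_left))) m)
        (Memory v r1 o) ((v * 4).+1 + B ^ e) w.
    apply: reaches_seq; rewrite -E1; apply: reaches_rewind; try lia.
    rewrite E1 /r1; clear E1 r1; rewrite /v; clear v vB; updeq.
  have le : (v * 4).+1 + ((v * 4).+1 + B ^ e).+2 <= B ^ (e + 6).
    have /= le64 := leq_expl 5 B2; rewrite expnD [B ^ 6]expnS.
    have X0 : 0 < B ^ e by rewrite expn_gt0 B0.
    move: X0 le64; move: (B ^ e) (B ^ 5) => X Z X0 Z64.
    have := leq_mul (leqnn (X * B)) Z64; have := leq_mul X0 (leqnn B).
    by have := leq_mul B2 X0; nia.
  apply: reaches_leq le _; apply: (@reaches_seq _ _ _ _ (Memory v r1 o)).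
    by apply: reaches_seek; try lia; rewrite e2 add0n.
  apply: reaches_ifblank; rewrite [m_pos _]/= ltnNge; case: (size u <= v) => /=.
    exact/(reaches_leq (leqnSn _))/back/(reaches_leq lp Hp).
  apply: reaches_ifone; rewrite [m_pos _]/=; case: (nth false u v).
    exact/back/(reaches_leq lp1 Hp1).
  exact/back/(reaches_leq lq Hq).
Qed.

End Compile.

(** * Loop programs compute polynomial-time functions *)

Section Polytime.
Context (D : nat).
Local Notation R := (D.+1.*2).

(** A register tape is initially blank, which does not represent zero: its marker has to be written
    first. *)
Definition init_markers : mach R :=
  @Mach _ unit tt (fun _ s => (None, fun i =>
    if (i == ord0) || (i == ord_max) then (s i, Stay) else (marker, Stay))).

(** Variable [0] must hold the input length, so the input is traversed once. Its left end carries no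
    mark, hence register [1] records the way back; it is zero again afterwards. *)
Definition gen_mach (p : gen) : mach R :=
  mseq init_markers
 (mseq (mseq (whilebit (mseq (inc 0) (mseq (inc 1) go_right)))
             (while0 1 (mseq (dec 1) go_left)))
       (compile D.+1 None 1 p)).

Lemma reaches_init u : exists2 T',
  runs (m_start init_markers) (tm_init (tm_of init_markers) u).2 1 T'
  & represents u (Memory 0 (fun => 0) [::]) T'.
Proof.
eexists; first exact: runs_exit.
split; rewrite /act_on /=.
- case: u => [|b u] /=; first by exists 1.
  by exists 0; rewrite /= cats0 drop0.
- by move=> k kR; rewrite rg_ord0 // rg_ord_max //=; exists 0.
- by rewrite eqxx.
Qed.

Lemma reaches_count u : reaches u
  (mseq (whilebit (mseq (inc 0) (mseq (inc 1) go_right)))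
        (while0 1 (mseq (dec 1) go_left)) : mach R)
  (Memory 0 (fun => 0) [::]) ((size u * 4).+1 + (size u * 3).+1)
  (Memory 0 (upd (fun => 0) 0 (size u)) [::]).
Proof.
set n := size u.
pose f i j := Memory i (upd (upd (fun => 0) 0 j) 1 i) [::].
have R1 : 1 < R by rewrite doubleS.
apply: (@reaches_seq _ _ _ _ _ _ (f n n)).
  have -> : Memory 0 (fun => 0) [::] = f 0 0.
    by congr Memory; apply/funext => k; rewrite /upd; repeat case: eqP.
  suff H i : reaches u (whilebit (mseq (inc 0) (mseq (inc 1) go_right)) : mach R)
      (f (n - i) (n - i)) (i * 4).+1 (f n n).
    by have := H n; rewrite subnn.
  elim: i => [|i [c lc Hc]].
    by rewrite subn0; exists 1 => //; exact: does_whilebit_stop.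
  have [lt|ge] := ltnP i n; last first.
    have e : n - i.+1 = n - i by lia.
    by rewrite e; exists c => //; lia.
  exists (3 + c).+1; first by lia.
  apply: does_whilebit_step Hc; first by rewrite /= -/n; lia.
  rewrite -(subnSK lt); set j := n - i.+1.
  apply: (does_seq (c1 := 1)); first by apply: does_inc; lia.
  apply: (does_seq (c1 := 1)); first by apply: does_inc.
  have := @does_right R u j (upd (upd (fun => 0) 0 j.+1) 1 j.+1) [::].
  congr (does _ _ (Memory _ _ _) _ _).
  by apply/funext => k; rewrite /upd; repeat (case: eqP => ?); subst.
have -> : upd (fun => 0) 0 n = upd (upd (fun => 0) 0 n) 1 (n - n).
  by apply/funext => k; rewrite /upd; repeat (case: eqP => ?); subst; lia.
pose h i := Memory (n - i) (upd (upd (fun => 0) 0 n) 1 (n - i)) [::].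
rewrite [f n n](_ : _ = h 0); last by rewrite /h subn0.
rewrite (_ : Memory 0 _ _ = h n); last by rewrite /h subnn.
apply: reaches_while0 => // i iv.
apply: (@reaches_seq _ _ _ _ _ 1 (Memory (n - i) (upd (upd (fun => 0) 0 n) 1 (n - i.+1)) [::]) 1).
  apply: reaches_dec => //=; first by rewrite /upd /=; lia.
  by apply/funext => k; rewrite /upd; repeat (case: eqP => ?); subst; lia.
by exists 1 => //; rewrite /h -(subnSK iv); exact: does_left.
Qed.

(** For [n >= 2] one has [n + 2 <= n ^ 2]; for smaller [n] the base is at most [3], and the additive
    constant takes over. *)
Lemma poly_bound_leq e n : (n + 2) ^ e <= poly_bound (2 * e + 3 ^ e) n.
Proof.
rewrite /poly_bound; have [n2|n2] := ltnP 1 n.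
  apply: (@leq_trans (n ^ (2 * e))).
    by rewrite expnM leq_expl //; nia.
  by apply: leq_trans (leq_addr _ _); rewrite leq_pexp2l ?leq_addr //; lia.
apply: leq_trans (leq_addl _ _); apply: leq_trans (leq_addl _ _).
by apply: leq_expl; lia.
Qed.

Lemma tm_output_out_tape (M : tm) (c : config M) (o : seq bool) :
  c.2 ord_max = (rev [seq Some (inl b) | b <- o], None, [::]) ->
  tm_output c = o.
Proof.
rewrite /tm_output => ->; rewrite revK pmap_cat cats0.
by elim: o => //= b o ->.
Qed.

Lemma polytime_gen p : scoped D.+1 1 p ->
  polytime (fun u => emit u 1 (upd (fun => 0) 0 (size u)) p).
Proof.
move=> sp; exists (tm_of (gen_mach p)).
exists (2 * (gen_exp p + 4).+1 + 3 ^ (gen_exp p + 4).+1).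
split=> [q s //|u /=].
set B := size u + 2.
have [||||||[c lc Hc] _] := @reaches_compile D.+1 u p 1 None (upd (fun => 0) 0 (size u)) [::] B sp.
- by [].
- by rewrite /B; lia.
- by rewrite /B; lia.
- by move=> k k2; rewrite /upd; case: eqP => // ?; subst.
- by move=> k; rewrite /upd /B; case: eqP => _; lia.
- by [].
have [c' lc' Hc'] := reaches_count u.
have [T0 R0 S0] := reaches_init u.
have [T1 R1 S1] := Hc' _ S0; have [T2 R2 S2] := Hc _ S1.
have Rall := runs_seq R0 (runs_seq R1 R2).
set t := poly_bound _ _.
have lt : 1 + (c' + c) <= t.
  apply: leq_trans (poly_bound_leq _ _); rewrite -/B.
  have B4 := leq_expl 3 (_ : 2 <= B); have B2 : 2 <= B by rewrite /B; lia.
  have X0 : 0 < B ^ gen_exp p by rewrite expn_gt0; lia.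
  rewrite -addnS expnD.
  move: lc lc' X0 (B4 B2); rewrite [B ^ 5]expnS [B ^ 4]expnS /=.
  rewrite (_ : size u = B - 2); last by rewrite /B addnK.
  move: (B ^ gen_exp p) (B ^ 3) => X Z lX lc' X0 Z8; clear -lX lc' X0 Z8 B2.
  have := leq_mul (leqnn (X * B)) (leq_mul B2 Z8).
  have := leq_mul X0 (leqnn B).
  have := leq_mul B2 X0.
  by nia.
have -> : tm_run (tm_of (gen_mach p)) u (nseq t false) = (None, T2).
  rewrite /tm_run -(subnKC lt) nseqD foldl_cat.
  by rewrite (tm_of_runs Rall) tm_of_halted.
split; first by [].
apply: tm_output_out_tape; have [_ _ E] := S2.
move: E; rewrite (_ : (fun k => _ k.*2) = upd (fun => 0) 0 (size u)) //.
by apply/funext => -[|k].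
Qed.

End Polytime.

(** * Counting worlds and tableaux *)

(** All fibres of the restriction along [i] have the same size: adding modulo 2 the extension [g] of
    [f] by [false] exchanges the fibres of [f] and of the zero assignment. The case of the full
    predicate then gives that size. The products stand for an equality of densities without
    division. *)
Lemma card_preim_inj (V C : finType) (i : C -> V) (Q : pred {ffun C -> bool}) :
  injective i ->
  #|[pred w : {ffun V -> bool} | Q [ffun c => w (i c)]]| * 2 ^ #|C|
    = #|Q| * 2 ^ #|V|.
Proof.
move=> iI; pose res (w : {ffun V -> bool}) := [ffun c => w (i c)].
pose fib f := \sum_(w | res w == f) 1.
have fibE f : fib f = fib [ffun=> false].
  pose g v := if [pick c | i c == v] is Some c then f c else false.
  have gE c : g (i c) = f c.
    rewrite /g; case: pickP => [c' /eqP/iI -> //|/(_ c)].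
    by rewrite eqxx.
  pose sh (w : {ffun V -> bool}) := [ffun v => w v (+) g v].
  have shK : involutive sh.
    by move=> w; apply/ffunP => v; rewrite !ffunE addbK.
  rewrite /fib (reindex_inj (inv_inj shK)) /=; apply: eq_bigl => w.
  apply/eqP/eqP => /ffunP E; apply/ffunP => c; have := E c; rewrite !ffunE gE.
    by case: (w _); case: (f c).
  by move->.
have cardQ (Q' : pred {ffun C -> bool}) :
    #|[pred w | Q' (res w)]| = #|Q'| * fib [ffun=> false].
  rewrite -sum1_card (partition_big res Q') //= -sum_nat_const.
  apply: eq_big => // f Qf; rewrite -(fibE f); apply: eq_bigl => w.
  by rewrite inE; case: eqP => [->|]; rewrite ?Qf ?andbF.
have := cardQ predT; rewrite !card_ffun card_bool => E.
rewrite (cardQ Q) -mulnA [_ * 2 ^ #|C|]mulnC -E; congr (_ * _).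
Qed.

(** The admissible patterns on [A + B] are the graphs of [F] over the assignments in [P], so there
    are [#|P|] of them; variables in neither image remain free and cancel. *)
Lemma card_determined (A B V : finType) (k : B -> V) (v : A -> V)
    (F : {ffun B -> bool} -> A -> bool) (P : pred {ffun B -> bool}) :
  injective k -> injective v -> (forall a b, v a <> k b) ->
  #|[pred w : {ffun V -> bool} |
      [forall a, w (v a) == F [ffun b => w (k b)] a] &&
      P [ffun b => w (k b)]]| * 2 ^ (#|A| + #|B|) = #|P| * 2 ^ #|V|.
Proof.
move=> kI vI vk.
pose i (c : A + B) := match c with inl a => v a | inr b => k b end.
have iI : injective i.
  by move=> [a|b] [a'|b'] //= => [/vI->|/vk|/esym/vk|/kI->].
pose Q (f : {ffun A + B -> bool}) :=
  [forall a, f (inl a) == F [ffun b => f (inr b)] a] && P [ffun b => f (inr b)].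
pose h (r : {ffun B -> bool}) : {ffun A + B -> bool} :=
  [ffun c => match c with inl a => F r a | inr b => r b end].
have hr r : [ffun b => h r (inr b)] = r.
  by apply/ffunP => b; rewrite !ffunE.
have cardQ : #|Q| = #|P|.
  have hI : injective h.
    by move=> r r' E; rewrite -(hr r) -(hr r') E.
  rewrite -(fintype.card_image hI P).
  apply: eq_card => f; apply/idP/fintype.imageP.
    case/andP=> /forallP fF fP; exists [ffun b => f (inr b)] => //.
    apply/ffunP => -[a|b]; rewrite !ffunE //; exact/eqP/fF.
  case=> r; rewrite unfold_in => Pr ->; rewrite unfold_in /Q hr Pr andbT.
  by apply/forallP => a; rewrite ffunE.
rewrite -cardQ -card_sum -(card_preim_inj _ iI); congr (_ * _).
apply: eq_card => w; rewrite !inE /Q.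
have -> : [ffun b => [ffun c => w (i c)] (inr b)] = [ffun b => w (k b)].
  by apply/ffunP => b; rewrite !ffunE.
by congr (_ && _); apply: eq_forallb => a; rewrite ffunE.
Qed.

Section Automaton.
Context (S : finType) (delta : bool -> S -> S -> S -> S -> S).

(* The first argument of [delta] after the coin is the state of cell [0], seen
   by all cells.  Cell [0] is its own left neighbour and cell [P] its own
   right neighbour. *)
Fixpoint tableau (P : nat) (ini : nat -> S) (r : nat -> bool) (t j : nat) : S :=
  if t is t'.+1 then
    let y := tableau P ini r t' in
    delta (r t') (y 0) (y j.-1) (y j) (y (minn j.+1 P))
  else ini j.

(* The boundary disturbs the cells at distance at most [t] from it only. *)
Lemma tableau_cone P (row : nat -> nat -> S) r :
  (forall t j, row t.+1 j =
     delta (r t) (row t 0) (row t j.-1) (row t j) (row t j.+1)) ->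
  forall t j, j + t <= P -> tableau P (row 0) r t j = row t j.
Proof.
move=> rowE; elim=> [//|t IH] j jP.
by rewrite /= rowE (_ : minn j.+1 P = j.+1) ?IH //; lia.
Qed.

End Automaton.

(** * Machine runs as tableaux of a cellular automaton *)

Section Simulation.
Context (M : tm).
Local Notation G := (symbol (tm_work M)).
Local Notation vec := {ffun 'I_(tm_tapes M).+1 -> G}.

(* Cell [0] holds the state and the scanned symbols, cell [j.+1] the [j]-th
   symbols to the left and to the right of the heads. *)
Definition cell : finType := ((tm_state M * vec) + (vec * vec))%type.

Definition row (c : config M) (j : nat) : cell :=
  if j is j'.+1 then
    inr ([ffun i => nth None (c.2 i).1.1 j'], [ffun i => nth None (c.2 i).2 j'])
  else inl (c.1, [ffun i => (c.2 i).1.2]).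

Definition left_sym (y : cell) (a : G) i : G :=
  if y is inr (L, _) then L i else a.
Definition right_sym (y : cell) (a : G) i : G :=
  if y is inr (_, R) then R i else a.

(** A head moving left shifts its tape to the right: left symbols come from [r], right symbols from
    [l]. When [l] is cell [0], the symbol pushed outwards is the one just written, [(act i).1]; in
    rows of configurations the default [None] is never met, as [r] is never cell [0]. *)
Definition cell_step (b : bool) (c l m r : cell) : cell :=
  if c is inl (q, x) then
    if tm_halt q then m else
    let: (q', act) := tm_step b q x in
    if m is inr (L, R) then
      inr ([ffun i => match (act i).2 with
                      | Stay => L i
                      | MoveL => left_sym r None i
                      | MoveR => left_sym l (act i).1 i
                      end],
           [ffun i => match (act i).2 with
                      | Stay => R i
                      | MoveL => right_sym l (act i).1 i
                      | MoveR => right_sym r None i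
                      end])
    else inl (q', [ffun i => match (act i).2 with
                             | Stay => (act i).1
                             | MoveL => left_sym r None i
                             | MoveR => right_sym r None i
                             end])
  else c.

Lemma row_next c b j : row (tm_next c b) j =
  cell_step b (row c 0) (row c j.-1) (row c j) (row c j.+1).
Proof.
rewrite /tm_next /=; case: ifP => // _.
case: (tm_step _ _ _) => q act.
case: j => [|j] /=.
  congr (inl (_, _)); apply/ffunP => i; rewrite !ffunE /=.
  by case: (c.2 i) (act i) => [[l x] r] [a [| |]] //=; [case: l|case: r].
congr (inr (_, _)); apply/ffunP => i; rewrite !ffunE /=.
  case: j => [|j] /=; rewrite ?ffunE.
    by case: (c.2 i) (act i) => [[l x] r] [a [| |]] //=; [case: l|case: r].
  case: (c.2 i) (act i) => [[l x] r] [a [| |]] //=; [case: l|case: r] => //=.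
case: j => [|j] /=; rewrite ?ffunE.
  by case: (c.2 i) (act i) => [[l x] r] [a [| |]] //=; [case: l|case: r].
by case: (c.2 i) (act i) => [[l x] r] [a [| |]] //=; [case: l|case: r].
Qed.

(** A cell of the initial row depends on the input through one symbol only, so the emitting program
    can select it by a single lookup. *)
Definition initial_cell (first : bool) (a : option bool) : cell :=
  let x : vec := [ffun i => if i == ord0 then omap inl a else None] in
  if first then inl (tm_start M, x) else inr ([ffun=> None], x).

Lemma row_init u j : row (tm_init M u) j = initial_cell (j == 0) (onth u j).
Proof.
rewrite /initial_cell; case: j => [|j] /=.
  by congr (inl (_, _)); apply/ffunP => i; rewrite !ffunE; case: eqP; case: u.
congr (inr (_, _)); apply/ffunP => i; rewrite !ffunE; case: eqP => // _.
- by case: u => [|b u] /=; rewrite nth_nil.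
- by rewrite nth_nil.
- case: u => [|b u] /=; first by rewrite nth_nil.
  have [lt|ge] := ltnP j (size u); last first.
    by rewrite onth_default // nth_default // size_map.
  by rewrite (onth_Some false) // (nth_map false).
- by rewrite nth_nil.
Qed.

Definition final_cell (y : cell) : bool :=
  if y is inl (q, _) then tm_accept q else false.

(** Cell [0] at time [t] depends on the initial cells up to [t] only, so the boundary at [P] is not
    felt. *)
Lemma tableau_run u P (r : nat -> bool) t : t <= P ->
  final_cell (tableau cell_step P (fun j => initial_cell (j == 0) (onth u j)) r t 0)
    = tm_accept (tm_run M u (mkseq r t)).1.
Proof.
move=> tP; pose c t := row (tm_run M u (mkseq r t)).
rewrite (_ : (fun j => _) = c 0); last first.
  by apply/funext => j; rewrite /c -row_init.
rewrite (tableau_cone (row := c)) ?add0n // => {tP}t j.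
by rewrite /c /tm_run mkseqS foldl_rcons row_next.
Qed.

End Simulation.

(** * Fact ABoxes *)

Lemma fsbig_uniq (V : nmodType) (T : choiceType) (A : set T) (s : seq T)
    (f : T -> V) : uniq s -> (forall x, x \notin s -> f x = 0%R) ->
  (\sum_(x \in A) f x = \sum_(x <- s | x \in A) f x)%R.
Proof.
move=> us fs; rewrite fsbig_mkcond (fsbigE s) //.
  rewrite [RHS]big_mkcond; apply: eq_big => x; first by rewrite in_setT.
  by [].
by move=> x _ xs; rewrite /patch fs // if_same.
Qed.

Lemma rvar_atom_inj m (ar : 'I_m -> nat) (delta : seq name) :
  injective (@rvar_atom m ar delta).
Proof.
move=> [p t] [q s] [] /= pq; move: t; rewrite pq => t E; congr existT.
apply/val_inj; apply: inj_map E => x y [] xy.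
exact: val_inj.
Qed.

Section KnowledgeBase.
Context {R : realType} {nd m : nat} {cds : 'I_nd -> concrete_domain}
  {ar : 'I_m -> nat} {delta : seq name}.

Local Notation fact0 := (AConcept (CName (nd := nd) [::]) [::]).
Local Notation query0 := (QConcept [::] [::]).
Local Notation wrld := (world ar delta).
Local Notation ind0 := ([:: [::]] : seq name).

Implicit Types (l : annot m) (w : wrld) (D : database cds).

Definition ground l : bool :=
  all (fun Vx => all (fun t : term => if t is inr _ then true else false) Vx.1.2) l.

Lemma asubst_ground l theta Vx : ground l -> Vx \in l ->
  asubst theta Vx.1 = Vx.1.
Proof.
move=> /allP gl /gl; case: Vx => [[p ts] b] /= g; rewrite /asubst /=; congr pair.
rewrite -[RHS]map_id; apply/eq_in_map => t /(allP g).
by case: t.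
Qed.

Definition in_world w l : bool := `[< instantiates Var l w >].

(** Ground atoms are fixed by every substitution, so the identity [Var] represents all of them; it
    is also most general, as every substitution factors through it. *)
Lemma instantiates_ground l theta w : ground l ->
  instantiates theta l w <-> in_world w l.
Proof.
move=> gl; split=> [H|/asboolP H]; [apply/asboolP|] => Vx lVx;
  have [X E wX] := H Vx lVx; exists X => //; rewrite -E.
  by rewrite !(asubst_ground _ gl lVx).
by rewrite !(asubst_ground _ gl lVx).
Qed.

Lemma is_mgu_Var l w : ground l -> in_world w l -> is_mgu Var l w.
Proof.
move=> gl /asboolP H; split=> // sigma _; exists sigma => v.
by [].
Qed.

Lemma satisfies_fact D w l : ground l ->
  satisfies (ind := ind0) (D, w) (tr_assertion fact0, l) <->
  (in_world w l -> D (FactC cds [::] (Ind [::]))).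
Proof.
move=> gl; split=> [H wl|H theta [/(instantiates_ground _ _ gl) /H Dq _]].
  apply: (H _ (is_mgu_Var gl wl) (fun=> Ind [::])) => v /=.
  by rewrite inE eqxx.
by move=> rho _.
Qed.

Lemma ground_world_annot w : ground (world_annot w).
Proof.
apply/allP => _ /mapP[X _ ->] /=; rewrite /rvar_atom /=.
by apply/allP => _ /mapP[c _ ->].
Qed.

Lemma in_world_world_annot w w' : in_world w (world_annot w') = (w == w').
Proof.
apply/asboolP/eqP => [H|-> _ /mapP[X _ ->]].
  apply/ffunP => X; have [|Y] := H (rvar_atom X, w' X).
    by apply/mapP; exists X => //; rewrite mem_enum.
  rewrite (asubst_ground (l := world_annot w') _ (Vx := (rvar_atom X, w' X))) //=.
  - by move=> /rvar_atom_inj <-.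
  - exact: ground_world_annot.
  - by apply/mapP; exists X => //; rewrite mem_enum.
exists X => //=.
rewrite (asubst_ground (l := world_annot w') _ (Vx := (rvar_atom X, w' X))) //.
- exact: ground_world_annot.
- by apply/mapP; exists X => //; rewrite mem_enum.
Qed.

(** The formula [FFalse] can only be satisfied vacuously, that is, when the annotation has no
    unifier in [w]. This turns condition (ii) on models into a statement about the distribution of
    worlds. *)
Lemma satisfies_world D w w' :
  satisfies (ind := ind0) (D, w) (FFalse, world_annot w') <-> w != w'.
Proof.
have gl := ground_world_annot w'.
split=> [H|/negP H theta [/(instantiates_ground _ _ gl)]]; last first.
  by rewrite in_world_world_annot.
apply/negP => /eqP ww'.
have wl : in_world w (world_annot w') by rewrite in_world_world_annot ww'.
have := H _ (is_mgu_Var gl wl) (fun=> Ind [::]).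
by apply => v /=; rewrite inE eqxx.
Qed.

Lemma mln_prob_nil w : mln_prob ([::] : mln R m) w = (#|wrld|%:R^-1)%R.
Proof.
have E w0 : mln_weight ([::] : mln R m) w0 = 1%R :> R.
  by rewrite /mln_weight big_nil expR0.
rewrite /mln_prob /mln_Z E mul1r.
by rewrite (eq_bigr (fun=> 1%R)) // sumr_const.
Qed.

Definition fact_abox (ls : seq (annot m)) : abox nd m :=
  [seq (fact0, l) | l <- ls].

Local Open Scope ring_scope.

Lemma In_fact_abox (ls : seq (annot m)) l : l \in ls ->
  List.In (tr_assertion fact0, l) (mk_onto [::] (fact_abox ls)).
Proof.
elim: ls => // l' ls IH; rewrite inE => /predU1P[->|/IH]; first by left.
by right.
Qed.

Lemma In_fact_aboxP (ls : seq (annot m)) Fl :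
  List.In Fl (mk_onto [::] (fact_abox ls)) ->
  exists2 l, l \in ls & Fl = (tr_assertion fact0, l).
Proof.
elim: ls => // l' ls IH /= [<-|/IH[l lls ->]].
  by exists l' => //; rewrite mem_head.
by exists l => //; rewrite inE lls orbT.
Qed.

(** Condition (ii) makes the distribution of the world uniform, and condition (i) makes every
    assertion true throughout the support. Hence the database contains the fact as soon as its world
    satisfies one of the annotations. *)
Lemma tight_prob_fact_ge (ls : seq (annot m)) (Pr : interp cds ar delta -> R) :
  all ground ls ->
  is_model (ind := ind0) (mk_onto [::] (fact_abox ls)) [::] Pr ->
  #|[pred w : wrld | has (in_world w) ls]|%:R / #|wrld|%:R <=
    prob (ind := ind0) Pr (query_fo query0, [::]).
Proof.
move=> /allP gls [[Pr0 Prdb Prfin Pr1] PrO PrM].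
pose sup := finmap.enum_fset (fset_set [set I | Pr I != 0]%classic).
have supP I : (I \in sup) = (Pr I != 0).
  by rewrite /sup in_fset_set //; apply/idP/idP; rewrite in_setE.
have sE (A : set (interp cds ar delta)) :
    \sum_(I \in A) Pr I = \sum_(I <- sup | I \in A) Pr I.
  apply: fsbig_uniq => [|I]; first exact: finmap.fset_uniq.
  by rewrite supP negbK => /eqP.
have total : \sum_(I <- sup) Pr I = 1.
  by rewrite -Pr1 sE; apply: eq_bigl => I; rewrite in_setT.
have sat_ls l I : l \in ls -> I \in sup ->
    satisfies (ind := ind0) I (tr_assertion fact0, l).
  move=> lls Isup; have := PrO _ (In_fact_abox lls).
  (* The satisfying interpretations already carry the whole mass, so the nonnegative weights of the
     others sum to zero and vanish one by one. *)
  rewrite /prob sE -total (bigID (mem [set I | satisfies (ind := ind0) I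
    (tr_assertion fact0, l)]%classic) predT) /=.
  move/eqP; rewrite -subr_eq0 opprD addNKr oppr_eq0.
  rewrite psumr_eq0 // => /allP /(_ _ Isup) /implyP H.
  apply: contrapT => nsat; have := H; rewrite notin_setE => /(_ nsat).
  by move: Isup; rewrite supP => /negP.
have marginal w : \sum_(I <- sup | I.2 == w) Pr I = #|wrld|%:R^-1.
  rewrite -(mln_prob_nil w) -PrM /prob sE -total.
  rewrite (bigID (fun I => I.2 == w) predT) /=.
  rewrite [X in _ = _ + X - _](eq_bigl (fun I => I \in [set I | satisfies
    (ind := ind0) I (FFalse, world_annot w)]%classic)); first by rewrite addrK.
  move=> [D w'] /=; apply/idP/idP; rewrite in_setE /= => /satisfies_world //.
rewrite /prob sE.
apply: (@le_trans _ _ (\sum_(I <- sup | has (in_world I.2) ls) Pr I)).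
  rewrite (partition_big (fun I => I.2) (fun w => has (in_world w) ls)) //=.
  rewrite mulr_natl -sumr_const; apply: ler_sum => w wls.
  rewrite -(marginal w) le_eqVlt; apply/orP; left; apply/eqP; apply: eq_bigl => I.
  by case: eqP => [->|]; rewrite ?wls ?andbT ?andbF.
rewrite [leRHS]big_mkcond [leLHS]big_mkcond !big_seq.
apply: ler_sum => -[D w] Isup; case: ifP => [/hasP[l lls wl]|_]; last first.
  by case: ifP.
rewrite mem_set //=; have /satisfies_fact Dq := sat_ls _ _ lls Isup.
have /(_ (gls _ lls) wl) {}Dq := Dq.
(* The query is the translated assertion itself under the empty annotation. *)
apply/(@satisfies_fact D w [::]) => //.
Qed.

(** The least database that the assertions permit in the world [w]; the uniform distribution over
    these pairs attains the infimum. *)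
Definition fact_db (ls : seq (annot m)) w : database cds :=
  [set f | has (in_world w) ls /\ f = FactC cds [::] (Ind [::])]%classic.

Definition fact_dist (ls : seq (annot m)) (I : interp cds ar delta) : R :=
  if `[< I.1 = fact_db ls I.2 >] then #|wrld|%:R^-1 else 0.

Lemma fact_distE (ls : seq (annot m)) (A : set (interp cds ar delta)) :
  \sum_(I \in A) fact_dist ls I =
  #|[pred w : wrld | (fact_db ls w, w) \in A]|%:R / #|wrld|%:R.
Proof.
pose f w : interp cds ar delta := (fact_db ls w, w).
rewrite (@fsbig_uniq _ _ A (map f (enum wrld))); last 2 first.
- by rewrite map_inj_uniq ?enum_uniq // => w w' [].
- move=> [D w] nI; rewrite /fact_dist; case: asboolP => //= E; exfalso.
  by move/negP: nI; apply; apply/mapP; exists w; rewrite ?mem_enum // E.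
rewrite big_map big_enum_cond /= mulr_natl -sumr_const.
apply: eq_big => w; first by rewrite inE.
by rewrite /fact_dist; case: asboolP.
Qed.

Lemma fact_dist_model (ls : seq (annot m)) : all ground ls ->
  is_model (ind := ind0) (mk_onto [::] (fact_abox ls)) [::] (fact_dist ls).
Proof.
move=> /allP gls; have W0 : #|wrld|%:R != 0 :> R.
  by rewrite pnatr_eq0 -lt0n; apply/card_gt0P; exists [ffun=> false].
have distT (A : set (interp cds ar delta)) :
    (forall w, A (fact_db ls w, w)) -> \sum_(I \in A) fact_dist ls I = 1.
  move=> HA; rewrite fact_distE (_ : #|_| = #|wrld|) ?divff //.
  by apply: eq_card => w; rewrite !inE mem_set.
split=> [|Fl /In_fact_aboxP[l lls ->]|w].
- split.
  + by move=> I; rewrite /fact_dist; case: ifP => // _; rewrite invr_ge0.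
  + move=> [D w]; rewrite /fact_dist; case: asboolP => [/= ->|]; last by rewrite eqxx.
    move=> _; split=> [c [f [_ ->]]|f e v v' [_]] //=.
    by case=> // -[<-]; rewrite mem_head.
  + apply: (@sub_finite_set _ _ [set` map (fun w => (fact_db ls w, w)) (enum wrld)]).
      move=> [D w] /=; rewrite /fact_dist; case: asboolP => [/= -> _|]; last by rewrite eqxx.
      by apply/mapP; exists w; rewrite ?mem_enum.
    exact: finite_seq.
  + exact: distT.
- apply: distT => w; apply/satisfies_fact; first exact: gls.
  by move=> wl; split=> //; apply/hasP; exists l.
- rewrite /prob fact_distE mln_prob_nil.
  have -> : #|[pred w0 | (fact_db ls w0, w0) \in [set I | satisfies (ind := ind0)
      I (FFalse : fo (opred nd), world_annot w)]%classic]| = #|wrld|.-1.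
    rewrite -(cardC1 w); apply: eq_card => w0; rewrite !inE.
    by apply/idP/idP; rewrite in_setE /= => /satisfies_world.
  have W1 : (0 < #|wrld|)%N by rewrite lt0n -(pnatr_eq0 R).
  by rewrite -{1}(divff W0) -mulrBl -natrB ?leq_pred // -subn1 subKn // mul1r.
Qed.

Lemma tight_prob_fact (ls : seq (annot m)) : all ground ls ->
  tight_prob (R := R) cds ar ind0 delta
    (mk_onto [::] (fact_abox ls)) [::] query0 =
  (#|[pred w : wrld | has (in_world w) ls]|%:R / #|wrld|%:R)%:E.
Proof.
move=> gls; apply/eqP; rewrite eq_le; apply/andP; split.
  apply: ereal_inf_lbound; exists (fact_dist ls).
    exact: fact_dist_model.
  congr (_%:E); rewrite /prob fact_distE; congr (_%:R / _).
  apply: eq_card => w; rewrite !inE; apply/idP/idP; rewrite in_setE /=.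
    by move/(@satisfies_fact _ w [::]) => [|//|]; rewrite // /in_world; apply/asboolP.
  move=> wls; apply/(@satisfies_fact _ w [::]) => //.
apply: le_ereal_inf_tmp => _ [Pr PrM <-]; rewrite lee_fin.
exact: tight_prob_fact_ge.
Qed.

End KnowledgeBase.

(** * The terms of the reduction *)

(* The random variable [(t, j, s)] says that cell [j] is in state number [s] at
   time [t]; the coin of time [t] is the variable [(t, 0, #|S|)]. *)
Definition literal : Type := (nat * nat * nat * bool)%type.

Section Terms.
Context (S : finType) (delta : bool -> S -> S -> S -> S -> S) (acc : pred S)
  (ini : nat -> S) (N : nat).

Definition rank (s : S) : nat := enum_rank s.

Lemma rank_inj : injective rank.
Proof. by move=> s s' /val_inj/enum_rank_inj. Qed.

Lemma rank_lt s : rank s < #|S|.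
Proof. exact: ltn_ord. Qed.

(** The sign [s != ini j] is the opposite of the correct value, so the term holds exactly when this
    variable is wrong. The last literal of [step_term] is signed in the same way. *)
Definition init_term (j : nat) (s : S) : seq literal :=
  [:: (0, j, rank s, s != ini j)].

Definition step_term (t : nat) (p : nat * nat * nat)
    (y : bool * S * S * S * S * S) : seq literal :=
  let: (jl, jm, jr) := p in let: (b, c, l, m, r, s) := y in
  [:: (t, 0, #|S|, b); (t, 0, rank c, true); (t, jl, rank l, true);
      (t, jm, rank m, true); (t, jr, rank r, true);
      (t.+1, jm, rank s, s != delta b c l m r)].

Definition final_term (s : S) : seq literal := [:: (N, 0, rank s, true)].

(** The boundary cases are listed apart, so that the emitting program can write every entry as a
    variable plus a constant. With the cells [0] to [N.+1] there are exactly [N] interior ones,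
    matching a loop bound that the program has at hand. *)
Definition positions : seq (nat * nat * nat) :=
  (0, 0, 1) :: [seq (j, j.+1, j.+2) | j <- iota 0 N] ++ [:: (N, N.+1, N.+1)].

Definition terms : seq (seq literal) :=
  flatten [seq [seq init_term j s | s <- enum S] | j <- iota 0 N.+2] ++
  flatten [seq flatten [seq [seq step_term t p y |
      y <- enum {: bool * S * S * S * S * S}] | p <- positions] |
    t <- iota 0 N] ++
  [seq final_term s | s <- enum S & acc s].

Variant terms_spec : seq literal -> Prop :=
| TermInit j s of j < N.+2 : terms_spec (init_term j s)
| TermStep t j y of t < N & j < N.+2 :
    terms_spec (step_term t (j.-1, j, minn j.+1 N.+1) y)
| TermFinal s of acc s : terms_spec (final_term s).

Lemma positionsP p : p \in positions ->
  exists2 j, j < N.+2 & p = (j.-1, j, minn j.+1 N.+1).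
Proof.
rewrite inE => /predU1P[->|]; first by exists 0; rewrite ?minnSS ?min0n.
rewrite mem_cat => /orP[/mapP[j]|]; rewrite ?mem_iota ?inE.
  by move=> /andP[_ jN] ->; exists j.+1; [lia | congr (_, _, _); rewrite /=; lia].
by move/eqP ->; exists N.+1 => //; congr (_, _, _); lia.
Qed.

Lemma mem_positions j : j < N.+2 -> (j.-1, j, minn j.+1 N.+1) \in positions.
Proof.
case: j => [|j] jN; first by rewrite minnSS min0n; exact: mem_head.
rewrite inE mem_cat; apply/orP; right; apply/orP.
have [jN'|jN'] := ltnP j N; [left|right].
  apply/mapP; exists j; first by rewrite mem_iota.
  by congr (_, _, _); lia.
by rewrite inE; apply/eqP; congr (_, _, _); rewrite /=; lia.
Qed.

Lemma termsP l : l \in terms -> terms_spec l.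
Proof.
rewrite /terms mem_cat (mem_cat l (flatten [seq _ | t <- iota 0 N])) => /or3P[/flatten_mapP[j]|/flatten_mapP[t]|/mapP[s]].
- by rewrite mem_iota => /andP[_ jN] /mapP[s _ ->]; constructor.
- rewrite mem_iota => /andP[_ tN] /flatten_mapP[p /positionsP[j jN ->]].
  by move=> /mapP[y _ ->]; constructor.
- by rewrite mem_filter => /andP[accs _] ->; constructor.
Qed.

Lemma mem_terms l : terms_spec l -> l \in terms.
Proof.
rewrite /terms mem_cat (mem_cat l (flatten [seq _ | t <- iota 0 N])); case=> [j s jN|t j y tN jN|s accs]; apply/or3P.
- apply: Or31; apply/flatten_mapP; exists j; first by rewrite mem_iota.
  by apply/mapP; exists s; rewrite ?mem_enum.
- apply: Or32; apply/flatten_mapP; exists t; first by rewrite mem_iota.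
  apply/flatten_mapP; exists (j.-1, j, minn j.+1 N.+1).
    exact: mem_positions.
  by apply/mapP; exists y; rewrite ?mem_enum.
- by apply: Or33; apply/mapP; exists s; rewrite // mem_filter accs mem_enum.
Qed.

Definition holds (X : nat -> nat -> nat -> bool) (l : seq literal) : bool :=
  all (fun x => let: (t, j, s, b) := x in X t j s == b) l.

(** If no term holds and row [t] is correct, the step term whose premises are the true entries of
    that row has a false last literal, which makes the next row correct. Conversely, in a correct
    tableau the premises of a step term single out the true entries, and then its last literal
    fails. The coin variables are only read. *)
Lemma terms_fail (X : nat -> nat -> nat -> bool) :
  let y := tableau delta N.+1 ini (fun t => X t 0 #|S|) in
  ~~ has (holds X) terms <->
  (forall t j s, t <= N -> j < N.+2 -> X t j (rank s) = (y t j == s)) /\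
  ~~ acc (y N 0).
Proof.
set y := tableau _ _ _ _; split=> [/hasPn H|[H nacc]]; last first.
  apply/hasPn => l /termsP[j s jN|t j [[[[[b c] l'] m] r] s] tN jN|s accs].
  - rewrite /= andbT H // (_ : y 0 j = ini j) // [_ == s]eq_sym.
    by case: (s == _).
  - have tN' := ltnW tN; have jl : j.-1 < N.+2 by lia.
    have jr : minn j.+1 N.+1 < N.+2 by lia.
    apply/negP => /= /and5P[/eqP b0].
    rewrite !(H t) // !eqb_id => /eqP yc /eqP yl /eqP ym /andP[/eqP yr].
    rewrite (H t.+1) // (_ : y t.+1 j = delta (X t 0 #|S|) (y t 0) (y t j.-1)
      (y t j) (y t (minn j.+1 N.+1))) // b0 yc yl ym yr [_ == s]eq_sym andbT.
    by case: (s == _).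
  - rewrite /= andbT H // eqb_id; apply: contra nacc => /eqP ->.
    exact: accs.
have Hy t j s : t <= N -> j < N.+2 -> X t j (rank s) = (y t j == s).
  elim: t j s => [|t IH] j s tN jN.
    have := H _ (mem_terms (TermInit s jN)).
    rewrite /= andbT (_ : y 0 j = ini j) //.
    by rewrite [_ == s]eq_sym; case: (X _ _ _); case: (s == _).
  have tN' := ltnW tN; have jl : j.-1 < N.+2 by lia.
  have jr : minn j.+1 N.+1 < N.+2 by lia.
  pose p := (X t 0 #|S|, y t 0, y t j.-1, y t j, y t (minn j.+1 N.+1), s).
  have := H _ (mem_terms (TermStep p tN jN)).
  rewrite (_ : y t.+1 j = delta (X t 0 #|S|) (y t 0) (y t j.-1) (y t j) (y t (minn j.+1 N.+1))) //.
  rewrite /= !IH // !eqxx /= andbT -/y [_ == s]eq_sym.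
  by case: (X _ _ _); case: (s == _).
split=> //; apply/negP => accy.
by have := H _ (mem_terms (TermFinal accy)); rewrite /= Hy // eqxx.
Qed.

(** A well-formed annotation may not contain an atom with both values. In a step term the cell
    premises are all positive, the coin has the number [#|S|], which is the rank of no state, and
    the last literal lies at a later time. *)
Lemma terms_coherent l t j s b b' : l \in terms ->
  (t, j, s, b) \in l -> (t, j, s, b') \in l -> b = b'.
Proof.
case/termsP=> [j' s' _|t' j' [[[[[b0 c] l'] m] r] s'] _ _|s' _].
- by rewrite !inE => /eqP[_ _ _ ->] /eqP[_ _ _ ->].
- have Kn s0 : (#|S| == rank s0) = false by rewrite gtn_eqF // rank_lt.
  have nK s0 : (rank s0 == #|S|) = false by rewrite ltn_eqF // rank_lt.
  rewrite !inE !xpair_eqE.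
  have [->|tt'] := eqVneq t t'.
    have -> : (t' == t'.+1) = false by lia.
    rewrite /= !orbF.
    have [->|sK] := eqVneq s #|S|.
      by rewrite !Kn !andbF !orbF => /andP[_ /eqP->] /andP[_ /eqP->].
    by rewrite !andbF /= => /or4P[] /andP[_ /eqP->] /or4P[] /andP[_ /eqP->].
  by rewrite /= => /andP[_ /eqP->] /andP[_ /eqP->].
- by rewrite !inE => /eqP[_ _ _ ->] /eqP[_ _ _ ->].
Qed.

Lemma terms_bounded l t j s b : l \in terms -> (t, j, s, b) \in l ->
  [/\ t < N.+1, j < N.+2 & s <= #|S|].
Proof.
have Kn s0 : rank s0 <= #|S| by rewrite ltnW // rank_lt.
case/termsP=> [j' s' jN|t' j' [[[[[b0 c] l'] m] r] s'] tN jN|s' _].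
- by rewrite !inE => /eqP[-> -> -> _].
- rewrite !inE => /or4P[/eqP[-> -> ->]|/eqP[-> -> ->]|/eqP[-> -> ->]|] //.
  + by split=> //; lia.
  + by split=> //; lia.
  + by split=> //; lia.
  by case/or3P=> /eqP[-> -> -> _]; split=> //; lia.
- by rewrite !inE => /eqP[-> -> -> _].
Qed.

End Terms.

(** * Random variables for the entries of the tableau *)

Definition unary (i : nat) : name := nseq i true.

Lemma unary_inj : injective unary.
Proof. by move=> i j /(congr1 size); rewrite !size_nseq. Qed.

Definition atom (t j s : nat) : matom 1 :=
  (ord0, [:: Cst (unary t); Cst (unary j); Cst (unary s)]).

Lemma atom_inj t j s t' j' s' :
  atom t j s = atom t' j' s' -> [/\ t = t', j = j' & s = s'].
Proof. by case=> /unary_inj -> /unary_inj -> /unary_inj ->. Qed.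

Definition literal_annot (x : literal) : matom 1 * bool :=
  let: (t, j, s, b) := x in (atom t j s, b).

Definition term_annot (l : seq literal) : annot 1 := map literal_annot l.

Lemma ground_term_annot l : ground (term_annot l).
Proof. by apply/allP => _ /mapP[[[[t j] s] b] _ ->]. Qed.

Definition ar3 : 'I_1 -> nat := fun=> 3.

(** One set of constants serves times, positions and state numbers, so many triples denote no
    tableau entry; these variables are free and cancel in the count. The two ranges overlap, but
    [seq_sub] ignores repetitions, which spares the program a maximum. *)
Definition constants (N K : nat) : seq name :=
  [seq unary i | i <- iota 0 N.+2] ++ [seq unary i | i <- iota 0 K.+1].

Section Worlds.
Context (N K : nat).
Local Notation cs := (constants N K).
Local Notation wrld := (world ar3 cs).

Lemma mem_constants1 i : i < N.+2 -> unary i \in cs.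
Proof.
by move=> lt; rewrite mem_cat; apply/orP; left; apply/map_f; rewrite mem_iota.
Qed.

Lemma mem_constants2 i : i <= K -> unary i \in cs.
Proof.
by move=> lt; rewrite mem_cat; apply/orP; right; apply/map_f; rewrite mem_iota.
Qed.

(** Names outside [cs] are replaced by [unary 0], so [variable] can be inverted only within the
    bounds. *)
Definition constant (i : nat) : seq_sub cs :=
  insubd (SeqSub (mem_constants1 (isT : 0 < N.+2))) (unary i).

Definition variable (t j s : nat) : rvar ar3 cs :=
  Tagged (fun p => (ar3 p).-tuple (seq_sub cs)) (i := ord0)
    [tuple constant t; constant j; constant s].

Lemma rvar_atom_variable t j s : t < N.+2 -> j < N.+2 -> s <= K ->
  rvar_atom (variable t j s) = atom t j s.
Proof.
move=> tN jN sK; rewrite /rvar_atom /= /constant /=.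
rewrite -!/(val _) !val_insubd mem_constants1 // mem_constants1 //.
by rewrite mem_constants2.
Qed.

Lemma in_world_term (w : wrld) l :
  (forall t j s b, (t, j, s, b) \in l -> [/\ t < N.+2, j < N.+2 & s <= K]) ->
  in_world w (term_annot l) = holds (fun t j s => w (variable t j s)) l.
Proof.
move=> lN; have gl := ground_term_annot l; apply/asboolP/allP.
  move=> H [[[t j] s] b] lx; have [tN jN sK] := lN _ _ _ _ lx.
  have [|X] := H (atom t j s, b); first exact: (map_f literal_annot lx).
  rewrite (asubst_ground (l := term_annot l) _ (Vx := (atom t j s, b))) //=.
    by rewrite -rvar_atom_variable // => /rvar_atom_inj <- ->.
  exact: (map_f literal_annot lx).
move=> H Vx lx; have := lx => /mapP[[[[t j] s] b] lx' E].
have [tN jN sK] := lN _ _ _ _ lx'.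
exists (variable t j s).
  by rewrite (asubst_ground _ gl lx) E rvar_atom_variable.
by have /eqP -> := H _ lx'; rewrite E.
Qed.

End Worlds.

Definition coins {N : nat} (f : {ffun 'I_N -> bool}) (t : nat) : bool :=
  if insub t is Some o then f o else false.

Lemma coinsE {N : nat} (f : {ffun 'I_N -> bool}) (o : 'I_N) : coins f o = f o.
Proof. by rewrite /coins valK. Qed.

Lemma tableau_ext (S : finType) (delta : bool -> S -> S -> S -> S -> S) P ini
    (r r' : nat -> bool) t j : (forall i, i < t -> r i = r' i) ->
  tableau delta P ini r t j = tableau delta P ini r' t j.
Proof.
elim: t j => // t IH j E; have E' i : i < t -> r i = r' i by move=> ?; exact/E/ltnW.
by rewrite /= E // !IH.
Qed.

Lemma card_coins N (Q : pred (seq bool)) :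
  #|[pred f : {ffun 'I_N -> bool} | Q (mkseq (coins f) N)]| =
  #|[pred r : N.-tuple bool | Q r]|.
Proof.
pose h (r : N.-tuple bool) := [ffun i => tnth r i].
pose g (f : {ffun 'I_N -> bool}) := [tuple f i | i < N].
have hK : cancel h g by move=> r; apply: eq_from_tnth => i; rewrite tnth_mktuple ffunE.
have gK : cancel g h by move=> f; apply/ffunP => i; rewrite ffunE tnth_mktuple.
rewrite -sum1_card -[RHS]sum1_card (reindex h); last by exists g => ? _.
apply: eq_bigl => r; rewrite !inE; congr (Q _).
apply: (@eq_from_nth _ false); rewrite size_mkseq ?size_tuple // => i iN.
rewrite nth_mkseq // (_ : i = Ordinal iN) // coinsE ffunE.
exact: tnth_nth.
Qed.

(** * Counting the worlds in which the DNF fails *)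

Section Counting.
Context (S : finType) (delta : bool -> S -> S -> S -> S -> S) (acc : pred S)
  (ini : nat -> S) (N : nat).
Local Notation wrld := (world ar3 (constants N #|S|)).
Local Notation ts := (terms delta acc ini N).

Lemma in_world_terms (w : wrld) :
  has (in_world w) (map term_annot ts) =
  has (holds (fun t j s => w (variable _ _ t j s))) ts.
Proof.
rewrite has_map; apply: eq_in_has => l lts /=; apply: in_world_term.
by move=> t j s b /(terms_bounded lts)[tN jN sK]; split=> //; exact: ltnW.
Qed.

Lemma variable_inj t j s t' j' s' : t < N.+2 -> j < N.+2 -> s <= #|S| ->
  t' < N.+2 -> j' < N.+2 -> s' <= #|S| ->
  variable N #|S| t j s = variable N #|S| t' j' s' ->
  [/\ t = t', j = j' & s = s'].
Proof.
move=> tN jN sK tN' jN' sK' E; apply: atom_inj.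
by rewrite -!(@rvar_atom_variable N #|S|) // E.
Qed.

(** In a failing world the [N.+1 * N.+2 * #|S|] cell variables are functions of the [N] coin
    variables, and the coins must lead to rejection. *)
Lemma card_failing :
  #|[pred w : wrld | ~~ has (in_world w) (map term_annot ts)]| *
    2 ^ (N.+1 * N.+2 * #|S| + N) =
  #|[pred r : {ffun 'I_N -> bool} |
      ~~ acc (tableau delta N.+1 ini (coins r) N 0)]| *
    2 ^ #|rvar ar3 (constants N #|S|)|.
Proof.
pose k (i : 'I_N) := variable N #|S| i 0 #|S|.
pose v (a : 'I_N.+1 * 'I_N.+2 * S) := variable N #|S| a.1.1 a.1.2 (rank a.2).
pose F (r : {ffun 'I_N -> bool}) (a : 'I_N.+1 * 'I_N.+2 * S) := tableau delta N.+1 ini (coins r) a.1.1 a.1.2 == a.2.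
have oN (i : 'I_N) : i < N.+2 by have := ltn_ord i; lia.
have oN1 (i : 'I_N.+1) : i < N.+2 by exact: leqW (ltn_ord i).
have rK (s : S) : rank s <= #|S| by exact/ltnW/rank_lt.
rewrite -(@card_determined _ _ _ k v F) /=; first last.
- move=> a b /variable_inj[] //; move=> _ _ E.
  by have := rank_lt a.2; rewrite E ltnn.
- move=> [[t j] s] [[t' j'] s'] /variable_inj[] //= /val_inj -> /val_inj ->.
  by move=> /rank_inj ->.
- by move=> i i' /variable_inj[] // /val_inj.
congr (_ * 2 ^ (_ + _)); last 2 first.
- by rewrite !card_prod !card_ord.
- by rewrite card_ord.
apply: eq_card => w; rewrite !inE in_world_terms.
set r := [ffun b => w (k b)].
(* The two coin sequences are compared only below [N], where [coins] does not fall back on its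
   default; a tableau up to time [N] reads no others. *)
have rE t i : t <= N -> i < t -> w (variable N #|S| i 0 #|S|) = coins r i.
  move=> tN it; have iN : i < N by lia.
  by rewrite (_ : i = Ordinal iN) // coinsE ffunE.
apply/idP/andP => [/terms_fail[H nacc]|[/forallP H nacc]].
  split; last by rewrite -(tableau_ext _ _ _ _ (fun i => @rE N i (leqnn N))).
  apply/forallP => -[[t j] s] /=; rewrite /v /F /= H //; last exact: ltn_ord t.
  by rewrite (tableau_ext _ _ _ _ (fun i => @rE t i (ltn_ord t))).
apply/terms_fail; split; last by rewrite (tableau_ext _ _ _ _ (fun i => @rE N i (leqnn N))).
move=> t j s tN jN; have tN' : t < N.+1 by [].
have := H (Ordinal tN', Ordinal jN, s); rewrite /v /F /= => /eqP ->.
by rewrite (tableau_ext _ _ _ _ (fun i => @rE t i tN)).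
Qed.

End Counting.

(** * Correctness of the reduction *)

Section Reduction.
Context (R : realType) (nd : nat) (cds : 'I_nd -> concrete_domain)
  (M : tm) (d : nat).
Implicit Types u : seq bool.

Local Notation K := #|cell M|.
Local Notation N u := (poly_bound d (size u)).

Definition machine_terms u : seq (seq literal) :=
  terms (@cell_step M) (@final_cell M)
    (fun j => initial_cell M (j == 0) (onth u j)) (N u).

(** The number of cell variables, plus one for the factor 1/2 of the majority test. *)
Definition exponent u : nat := ((N u).+1 * (N u).+2 * K).+1.

Definition threshold u : rat := ((2 ^ exponent u).-1%:R / (2 ^ exponent u)%:R)%R.

Definition reduction u : instance nd 1 :=
  Instance [:: [::]] (constants (N u) K)
    (fact_abox (map term_annot (machine_terms u))) (QConcept [::] [::])
    (threshold u).

Lemma all_ground_terms u : all (@ground 1) (map term_annot (machine_terms u)).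
Proof. by apply/allP => _ /mapP[l _ ->]; exact: ground_term_annot. Qed.

Lemma reduction_wf u : instance_wf cds ar3 ([::] : mln R 1) [::] (reduction u).
Proof.
have mem_cs t j s b l : l \in machine_terms u -> (t, j, s, b) \in l ->
    [/\ unary t \in constants (N u) K, unary j \in constants (N u) K
      & unary s \in constants (N u) K].
  move=> lm /(terms_bounded lm)[tN jN sK].
  by split; [apply: mem_constants1; lia | exact: mem_constants1 | exact: mem_constants2].
split=> //=.
- by move=> _ /In_fact_aboxP[l _ ->].
- by move=> _ j p fs ts /In_fact_aboxP[l _ ->] /= [].
- move=> _ /In_fact_aboxP[_ /mapP[l lm ->] ->]; split=> /=.
    move=> _ /mapP[[[[t j] s] b] xl ->]; split=> //= c.
    have [tc jc sc] := mem_cs _ _ _ _ _ lm xl.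
    move=> cin; rewrite in_cons; apply/orP; right.
    by move: cin; rewrite !inE => /or3P[] /eqP->.
  move=> _ _ /mapP[[[[t j] s] b] xl ->] /mapP[[[[t' j'] s'] b'] xl' ->] /=.
  move=> ne [theta E]; apply: ne.
  have {}E : atom t j s = atom t' j' s' by [].
  have [e1 e2 e3] := atom_inj E; subst t' j' s'.
  by rewrite (terms_coherent lm xl xl').
- have /(map_f term_annot) := mem_terms (delta := @cell_step M) (acc := @final_cell M)
    (TermInit _ _ (fun j => initial_cell M (j == 0) (onth u j))
       (initial_cell M true None) (isT : 0 < (N u).+2)).
  move=> /(@In_fact_abox nd 1) H; eexists; exists [:: Cst [::]]; split; first exact: H.
  by left.
Qed.

Local Open Scope ring_scope.

(** Passing to complements, the inequality reads [bad * 2 ^ exponent u <= 2 ^ V]. Multiplied by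
    [2 ^ N u], its left side becomes [2 * rej * 2 ^ V] by [card_failing], and [2 ^ V] cancels. *)
Lemma reduction_prob u :
  ((ratr (threshold u) : R)%:E <=
     tight_prob (R := R) cds ar3 [:: [::]] (constants (N u) K)
     (mk_onto [::] (fact_abox (map term_annot (machine_terms u)))) [::]
     (QConcept [::] [::]))%E <->
  (2 * #|[pred r : (N u).-tuple bool | ~~ tm_accept (tm_run M u r).1]| <= 2 ^ N u)%N.
Proof.
rewrite tight_prob_fact ?all_ground_terms // lee_fin.
set good := #|_|; set V := #|rvar ar3 (constants (N u) K)|.
set rej := #|[pred r : _.-tuple _ | _]|.
have cardW : #|world ar3 (constants (N u) K)| = (2 ^ V)%N.
  by rewrite card_ffun card_bool.
have := card_failing (@cell_step M) (@final_cell M)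
  (fun j => initial_cell M (j == 0) (onth u j)) (N u).
rewrite -/(machine_terms u) -/V; set bad := #|_|.
have -> : #|[pred r : {ffun 'I_(N u) -> bool} | ~~ final_cell (tableau
   (@cell_step M) (N u).+1 (fun j => initial_cell M (j == 0) (onth u j)) (coins r) (N u) 0)]| = rej.
  apply: etrans (card_coins _ (fun r => ~~ tm_accept (tm_run M u r).1)).
  by apply: eq_card => r; rewrite !inE tableau_run.
move=> Ebad.
have Egood : (good + bad = 2 ^ V)%N.
  by rewrite -cardW -(cardC [pred w | has (in_world w) (map term_annot (machine_terms u))]).
have V0 : (0 < 2 ^ V :> R)%R by rewrite exprn_gt0.
have e0 : (0 < (2 ^ exponent u)%:R :> R)%R by rewrite ltr0n expn_gt0.
have -> : ratr (threshold u) = 1 - ((2 ^ exponent u)%:R)^-1 :> R.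
  rewrite /threshold fmorph_div /= !ratr_nat -subn1 natrB ?expn_gt0 //.
  by rewrite mulrBl mul1r divff ?gt_eqF.
have -> : good%:R / #|world ar3 (constants (N u) K)|%:R = 1 - bad%:R / (2 ^ V)%:R :> R.
  rewrite cardW -Egood (natrD _ good bad); apply/eqP; rewrite eq_sym subr_eq -mulrDl divff //.
  by rewrite -natrD Egood natrX gt_eqF.
rewrite lerD2l lerN2 ler_pdivrMr ?natrX // mulrC ler_pdivlMr -?natrX //.
rewrite -natrM ler_nat.
rewrite -(leq_pmul2r (m := 2 ^ N u)) ?expn_gt0 //.
rewrite /exponent expnS.
have -> : (bad * (2 * 2 ^ ((N u).+1 * (N u).+2 * K)) * 2 ^ N u =
  2 * rej * 2 ^ V)%N.
  by rewrite -[(2 * rej * _)%N]mulnA -Ebad expnD; lia.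
by rewrite [(2 ^ V * _)%N]mulnC leq_pmul2r ?expn_gt0.
Qed.

(** If [u] is in [L], the rejecting sequences are the errors and fewer than half; if not, the
    accepting ones are, so more than half reject. Injectivity of [encode] recovers the instance from
    its code. *)
Lemma reduction_correct (L : language) u : (error_prob M L u (N u) < 1 / 2)%R ->
  L u <-> data_problem cds ar3 ([::] : mln R 1) [::] (encode (reduction u)).
Proof.
set rej := #|[pred r : (N u).-tuple bool | ~~ tm_accept (tm_run M u r).1]|.
move=> err; apply: (@iff_trans _ (2 * rej <= 2 ^ N u)%N).
  have P0 : 0 < (2 ^ N u)%:R :> rat by rewrite ltr0n expn_gt0.
  move: err; rewrite /error_prob /coin_prob ltr_pdivrMr // mulrC mulrA ltr_pdivlMr //.
  rewrite mulr1 -[2]/(2%:R) -natrM ltr_nat.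
  case: asboolP => Lu H; split=> //.
  - move=> _; apply/ltnW; apply: leq_ltn_trans H; rewrite mulnC leq_mul2r /=.
    by apply: subset_leq_card; apply/fintype.subsetP => r; rewrite !inE; case: tm_accept.
  - move=> le; exfalso; move: H.
    have : (#|[pred r : (N u).-tuple bool | tm_accept (tm_run M u r).1 != false]| + rej = 2 ^ N u)%N.
      rewrite -[X in _ = (X ^ _)%N]card_bool -card_tuple.
      rewrite -(cardC [pred r : (N u).-tuple bool | tm_accept (tm_run M u r).1 != false]).
      by congr addn; apply: eq_card => r; rewrite !inE; case: tm_accept.
    by move: le; move: #|_| => a; lia.
rewrite -reduction_prob; split=> [H|[i [/encode_inj -> _ //]]].
by exists (reduction u); split=> //; exact: reduction_wf.
Qed.

End Reduction.

(** * Writing the instance *)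

Lemma flatten_nseq_const (T : Type) n k (x : T) :
  flatten (nseq n (nseq k x)) = nseq (n * k) x.
Proof. by elim: n => //= n ->; rewrite -nseqD mulSn. Qed.

Lemma flatten_iota_const (T : Type) (s : seq T) n m :
  flatten [seq s | _ <- iota m n] = flatten (nseq n s).
Proof. by elim: n m => //= n IH m; rewrite IH. Qed.

Lemma odd_divn_expn_pred e i : odd ((2 ^ e).-1 %/ 2 ^ i) = (i < e).
Proof.
elim: i e => [|i IH] [|e]; rewrite ?div0n //.
  by rewrite divn1 expnS -subn1 oddB ?muln_gt0 ?expn_gt0 // oddM.
rewrite [2 ^ i.+1]expnS divnMA (_ : _ %/ 2 = (2 ^ e).-1) ?IH //.
by have := expn_gt0 2 e; rewrite expnS /=; lia.
Qed.

(** Numerator and denominator of the threshold are exponentially large, but their bit patterns are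
    regular enough for a counting loop. *)
Lemma bits_expn_pred e : bits (2 ^ e.+1).-1 = nseq e.+1 true.
Proof.
have e0 := expn_gt0 2 e.
rewrite /bits (_ : trunc_log _ _ = e); last first.
  apply: trunc_log_eq => //.
  by rewrite ltn_predL expn_gt0 andbT -ltnS prednK ?expn_gt0 // expnS; lia.
apply: (@eq_from_nth _ true); rewrite size_mkseq ?size_nseq // => i ie.
by rewrite nth_mkseq // nth_nseq ie odd_divn_expn_pred.
Qed.

Lemma bits_expn e : bits (2 ^ e) = rcons (nseq e false) true.
Proof.
rewrite /bits trunc_expnK //.
apply: (@eq_from_nth _ true); rewrite size_mkseq ?size_rcons ?size_nseq // => i ie.
rewrite nth_mkseq // nth_rcons size_nseq.
have [lt|ge] := ltnP i e.
  by rewrite nth_nseq lt -expnB ?(ltnW lt) // oddX subn_eq0 leqNgt lt.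
have -> : i = e by lia.
by rewrite eqxx divnn expn_gt0.
Qed.

Definition enc (t : stree) : seq bool := flatten (map code_token (GenTree.encode t)).

Lemma enc_leaf s : enc (SLeaf s) = code_token (inr s).
Proof. by rewrite /enc /= cats0. Qed.

Lemma enc_node n f : enc (SNode n f) =
  code_token (inl n.+1) ++ flatten (map enc f) ++ code_token (inl 0).
Proof.
have E x : flatten (map code_token [:: x]) = code_token x by exact: cats0.
rewrite /enc (_ : GenTree.encode _ = [:: inl n.+1] ++
  flatten (map (@GenTree.encode _) f) ++ [:: inl 0]); last by rewrite /= cats1.
rewrite !map_cat !flatten_cat.
rewrite !E; congr (_ ++ (_ ++ _)).
by elim: f => //= t f IH; rewrite map_cat flatten_cat IH.
Qed.

Definition gseq (ps : seq gen) : gen := foldr GSeq (GEmit [::]) ps.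

Definition gnode (n : nat) (ps : seq gen) : gen :=
  GSeq (GEmit (code_token (inl n.+1)))
    (GSeq (gseq ps) (GEmit (code_token (inl 0)))).

Definition gconst (t : stree) : gen := GEmit (enc t).

(** Every time, position or state number in a term is a constant or a program variable plus a
    constant. *)
Definition gindex : Type := (option nat * nat)%type.

Definition ival (val : nat -> nat) (i : gindex) : nat :=
  if i.1 is Some x then val x + i.2 else i.2.

(** [code_token] puts [true] before every bit, so each unit of a unary name becomes two bits
    [true]. *)
Definition gunary (i : gindex) : gen :=
  GSeq (GEmit [:: true])
    (GSeq (if i.1 is Some x then GFor x (GEmit [:: true; true]) else GEmit [::])
          (GEmit (rcons (nseq (i.2).*2 true) false))).

Definition sliteral : Type := (gindex * gindex * gindex * bool)%type.

Definition lval (val : nat -> nat) (x : sliteral) : literal :=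
  let: (t, j, s, b) := x in (ival val t, ival val j, ival val s, b).

Definition gliteral (x : sliteral) : gen :=
  let: (t, j, s, b) := x in
  gnode b [:: gconst (tree_nat 0);
              gnode 0 [seq gnode 1 [:: gunary i] | i <- [:: t; j; s]]].

Definition gterm (nd : nat) (l : seq sliteral) : gen :=
  gnode 0 [:: gconst (tree_assertion (AConcept (nd := nd) (CName [::]) [::]));
              gnode 0 (map gliteral l)].

Section Emission.
Context (u : seq bool).

Lemma emit_gseq d val ps :
  emit u d val (gseq ps) = flatten (map (emit u d val) ps).
Proof. by elim: ps => //= p ps ->. Qed.

Lemma emit_gnode d val n ps f :
  flatten (map (emit u d val) ps) = flatten (map enc f) ->
  emit u d val (gnode n ps) = enc (SNode n f).
Proof. by move=> E; rewrite enc_node -E -emit_gseq. Qed.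

Lemma emit_cons d val p t ps ts : emit u d val p = enc t ->
  flatten (map (emit u d val) ps) = flatten (map enc ts) ->
  flatten (map (emit u d val) (p :: ps)) = flatten (map enc (t :: ts)).
Proof. by rewrite /= => -> ->. Qed.

Lemma emit_gunary d val i :
  emit u d val (gunary i) = enc (SLeaf (unary (ival val i))).
Proof.
rewrite enc_leaf /gunary /ival /unary; case: i => [[x|] c] /=.
  rewrite flatten_iota_const (flatten_nseq_const _ 2) -rcons_cat -nseqD.
  rewrite map_nseq (flatten_nseq_const _ 2) //.
  by rewrite mulnDl !muln2.
by rewrite map_nseq (flatten_nseq_const _ 2) muln2.
Qed.

Lemma emit_gliteral d val x :
  emit u d val (gliteral x) = enc (tree_lit (literal_annot (lval val x))).
Proof.
case: x => [[[t j] s] b]; rewrite /gliteral /tree_lit.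
apply: emit_gnode; apply: emit_cons => //; apply: emit_cons => //.
have E i : emit u d val (gnode 1 [:: gunary i]) =
    enc (tree_term (Cst (unary (ival val i)))).
  by apply: emit_gnode; apply: emit_cons => //; exact: emit_gunary.
by apply: emit_gnode; do 3!(apply: emit_cons; first exact: E).
Qed.

Lemma emit_gterm nd d val l :
  emit u d val (gterm nd l) =
  enc (tree_annotated (AConcept (nd := nd) (CName [::]) [::],
    term_annot (map (lval val) l))).
Proof.
apply: emit_gnode; apply: emit_cons => //; apply: emit_cons => //.
apply: emit_gnode; rewrite /term_annot -!map_comp; congr flatten.
by apply: eq_map => x; exact: emit_gliteral.
Qed.

End Emission.

Lemma flatten_nseq_mul (T : Type) a b (w : seq T) :
  flatten (nseq a (flatten (nseq b w))) = flatten (nseq (a * b) w).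
Proof. by elim: a => //= a ->; rewrite mulSn nseqD flatten_cat. Qed.

Lemma flatten_map_flatten (T T' : Type) (f : T -> seq T') ss :
  flatten (map f (flatten ss)) = flatten [seq flatten (map f s) | s <- ss].
Proof. by elim: ss => //= s ss <-; rewrite map_cat flatten_cat. Qed.

(** Consecutive integers are coprime, so the fraction is already in lowest terms. *)
Lemma threshold_num_den (e : nat) (q := ((2 ^ e).-1%:R / (2 ^ e)%:R)%R : rat) :
  numq q = Posz (2 ^ e).-1 /\ denq q = Posz (2 ^ e).
Proof.
have e0 := expn_gt0 2 e.
have co : coprime (2 ^ e).-1 (2 ^ e) by rewrite -{2}(prednK e0) coprimenS.
rewrite /q -[((2 ^ e).-1%:R)%R]/((Posz (2 ^ e).-1)%:~R)%R -[((2 ^ e)%:R)%R]/((Posz (2 ^ e))%:~R)%R.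
rewrite coprimeq_num // coprimeq_den //.
rewrite gtr0_sg ?mul1r; last by rewrite ltz_nat.
by rewrite -[Posz _ == 0]/(2 ^ e == 0)%N expn_eq0.
Qed.

Section Scoping.
Context (D d : nat).

Lemma scoped_gfor x p :
  scoped D d (GFor x p) = [&& x < d, d < D & scoped D d.+1 p].
Proof. by []. Qed.

Lemma scoped_gseq ps : scoped D d (gseq ps) = all (scoped D d) ps.
Proof. by elim: ps => //= p ps ->. Qed.

Lemma scoped_gnode n ps : scoped D d (gnode n ps) = all (scoped D d) ps.
Proof. by rewrite -scoped_gseq /= andbT. Qed.

Definition index_below (i : gindex) : bool := if i.1 is Some x then x < d else true.

Lemma scoped_gunary i : d < D -> index_below i -> scoped D d (gunary i).
Proof.
by move=> dD; rewrite /index_below; case: i => [[x|] c] //= ->; rewrite dD.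
Qed.

Definition literal_below (x : sliteral) : bool :=
  let: (t, j, s, _) := x in [&& index_below t, index_below j & index_below s].

Lemma scoped_gterm nd l : d < D -> all literal_below l -> scoped D d (gterm nd l).
Proof.
move=> dD /allP lb; rewrite scoped_gnode; apply/and3P; split=> //.
rewrite scoped_gnode all_map; apply/allP => -[[[t j] s] b] /lb /and3P[tb jb sb].
change (scoped D d (gliteral (t, j, s, b))).
rewrite scoped_gnode; apply/and3P; split=> //.
rewrite scoped_gnode; apply/and4P.
by split=> //; rewrite scoped_gnode; apply/andP; split=> //; exact: scoped_gunary.
Qed.

End Scoping.

(** * The program that prints the instance *)

Section Program.
Context (nd : nat) (M : tm) (d : nat).
Local Notation S := (cell M).
Local Notation K := #|cell M|.
Local Notation const c := ((None, c) : gindex).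

(** Prints [n ^ k] bits for input length [n], so that [GLet] can turn the length of the output into
    a variable. *)
Fixpoint gpow (k : nat) : gen :=
  if k is k'.+1 then GFor 0 (gpow k') else GEmit [:: true].

(* Inside the program variable [1] is the number [N] of steps, [2] is [N + 2],
   [3] the current time (or position) and [4] the current position. *)
Definition ginit_cell (first : bool) (a : option bool) : gen :=
  gseq [seq gterm nd [:: (const 0, (Some 3, 0), const (rank s),
                          s != initial_cell M first a)] | s <- enum S].

Definition ginit : gen :=
  let inp first := GInp 3 (ginit_cell first None)
    (ginit_cell first (Some false)) (ginit_cell first (Some true)) in
  GFor 2 (GIfZ 3 (inp true) (inp false)).

Definition sstep (p : gindex * gindex * gindex) (y : bool * S * S * S * S * S) :
    seq sliteral :=
  let: (jl, jm, jr) := p in let: (b, c, l, m, r, s) := y in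
  [:: (Some 3, 0, const 0, const K, b);
      (Some 3, 0, const 0, const (rank c), true);
      (Some 3, 0, jl, const (rank l), true);
      (Some 3, 0, jm, const (rank m), true);
      (Some 3, 0, jr, const (rank r), true);
      (Some 3, 1, jm, const (rank s), s != cell_step b c l m r)].

Definition gstep_at (p : gindex * gindex * gindex) : gen :=
  gseq [seq gterm nd (sstep p y) | y <- enum {: bool * S * S * S * S * S}].

Definition gstep : gen :=
  GFor 1 (gseq [:: gstep_at (const 0, const 0, const 1);
    GFor 1 (gstep_at ((Some 4, 0), (Some 4, 1), (Some 4, 2)));
    gstep_at ((Some 1, 0), (Some 1, 1), (Some 1, 1))]).

Definition gfinal : gen :=
  gseq [seq gterm nd [:: ((Some 1, 0), const 0, const (rank s), true)] |
    s <- enum S & final_cell s].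

(** The factor [N.+1] is [N] rounds and one further copy; the factor [K], fixed with the machine, is
    unrolled. *)
Definition gcount (w : seq bool) : gen :=
  let p := GFor 2 (GEmit (flatten (nseq K w))) in GSeq (GFor 1 p) p.

Definition ginstance : gen :=
  gnode 0 [:: gconst (tree_names [:: [::]]);
    gnode 0 [:: GFor 2 (gunary (Some 3, 0));
                gseq [seq gunary (const i) | i <- iota 0 K.+1]];
    gnode 0 [:: ginit; gstep; gfinal];
    gconst (tree_query (QConcept [::] [::]));
    gnode 0 [:: gseq [:: GEmit [:: true]; gcount [:: true; true];
                         GEmit [:: true; true; false]];
                gseq [:: GEmit [:: true]; gcount [:: true; false];
                         GEmit [:: true; false; true; true; false]]]].

Definition gmain : gen :=
  GLet (GSeq (gpow d) (GEmit (nseq d true)))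
    (GLet (GSeq (GFor 1 (GEmit [:: true])) (GEmit [:: true; true])) ginstance).

Lemma scoped_gpow D e k : 0 < e -> e + k <= D -> scoped D e (gpow k).
Proof.
elim: k e => //= k IH e e0 ek.
by rewrite e0 IH // ?andbT; lia.
Qed.

(** The nested loops of [gpow] reach depth [d + 2], and all other parts stay below [8]. *)
Lemma scoped_gmain : scoped (d + 10).+1 1 gmain.
Proof.
have D5 k : k < 8 -> k < (d + 10).+1 by lia.
have stepS e a b c : 3 < e < 8 -> index_below e a -> index_below e b ->
    index_below e c -> scoped (d + 10).+1 e (gstep_at (a, b, c)).
  move=> /andP[e3 e8] ha hb hc; rewrite scoped_gseq all_map; apply/allP.
  move=> [[[[[b0 c0] l] m] r] s] _; apply: scoped_gterm; first exact: D5.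
  by move: ha hb hc; rewrite /= /index_below /= e3 => -> -> ->.
have initS f a : scoped (d + 10).+1 4 (ginit_cell f a).
  by rewrite scoped_gseq all_map; apply/allP => s _; apply: scoped_gterm => //; exact: D5.
have unS i : index_below 4 i -> scoped (d + 10).+1 4 (gunary i).
  by move=> ib; apply: scoped_gunary => //; exact: D5.
have -> : scoped (d + 10).+1 1 gmain =
  [&& 1 < (d + 10).+1, scoped (d + 10).+1 2 (gpow d) && true,
    2 < (d + 10).+1, [&& 1 < 3, 3 < (d + 10).+1 & true] && true
    & scoped (d + 10).+1 3 ginstance] by [].
rewrite scoped_gpow ?(D5 1) ?(D5 2) ?(D5 3) //; last by lia.
apply/and5P; split=> //; rewrite scoped_gnode; apply/and5P; split=> //.
- rewrite scoped_gnode; apply/and3P; split=> //.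
    by apply/and3P; split=> //; [exact: D5 | exact: (unS (Some 3, 0))].
  rewrite scoped_gseq all_map; apply/allP => i _.
  by apply: scoped_gunary => //; exact: D5.
- rewrite scoped_gnode; apply/and4P; split=> //.
  + apply/and3P; split=> //; first exact: D5.
    by apply/and3P; split=> //; apply/and5P; split=> //; exact: D5.
  + rewrite scoped_gfor (D5 3) //=.
    rewrite scoped_gseq; apply/and4P; split=> //.
    * rewrite -scoped_gseq; exact: (stepS 4 (const 0) (const 0) (const 1) isT isT isT isT).
    * rewrite (D5 4) //=; exact: (stepS 5 (Some 4, 0) (Some 4, 1) (Some 4, 2) isT isT isT isT).
    * exact: (stepS 4 (Some 1, 0) (Some 1, 1) (Some 1, 1) isT isT isT isT).
  + rewrite scoped_gseq all_map; apply/allP => s _.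
    by apply: scoped_gterm => //; exact: D5.
- have countS w : scoped (d + 10).+1 3 (gcount w).
    apply/andP; split; apply/and3P; split=> //; try exact: D5.
    by apply/and3P; split=> //; exact: D5.
  rewrite andbT scoped_gnode; apply/and3P; split=> //;
    by rewrite scoped_gseq; apply/and4P; split.
Qed.

End Program.

Section ProgramOutput.
Context (nd : nat) (M : tm) (d : nat) (u : seq bool).
Local Notation S := (cell M).
Local Notation K := #|cell M|.
Local Notation N := (poly_bound d (size u)).

Definition main_env : nat -> nat :=
  upd (upd (upd (fun=> 0) 0 (size u)) 1 N) 2 N.+2.

Local Notation E := (fun l => enc (tree_annotated
  (AConcept (nd := nd) (CName [::]) [::], term_annot l))).

Lemma emit_gfor e val x p : emit u e val (GFor x p) =
  flatten [seq emit u e.+1 (upd val e j) p | j <- iota 0 (val x)].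
Proof. by []. Qed.

Lemma emit_gterms (T : Type) e val (f : T -> seq sliteral) s :
  emit u e val (gseq [seq gterm nd (f x) | x <- s]) =
  flatten (map E [seq map (lval val) (f x) | x <- s]).
Proof.
rewrite emit_gseq -!map_comp; congr flatten; apply: eq_map => x.
exact: emit_gterm.
Qed.

Lemma emit_ginit : emit u 3 main_env (ginit nd M) =
  flatten (map E (flatten [seq [seq
    init_term (fun j => initial_cell M (j == 0) (onth u j)) j s
     | s <- enum S] | j <- iota 0 N.+2])).
Proof.
rewrite flatten_map_flatten -map_comp emit_gfor; congr flatten.
apply: eq_map => j; rewrite /comp /init_term.
have H f a : emit u 4 (upd main_env 3 j) (ginit_cell nd M f a) =
    flatten (map E [seq [:: (0, j, rank s, s != initial_cell M f a)] | s <- enum S]).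
  rewrite emit_gterms; congr (flatten (map E _)); apply: eq_map => s.
  by rewrite /= /ival /upd /= addn0.
rewrite /= -!/(emit _ _ _ _) /upd eqxx -/(upd _ _ _) !H.
have [ge|lt] := leqP (size u) j.
  by rewrite onth_default //; case: (j == 0).
rewrite (onth_Some false lt).
by case: (j == 0); case: (nth _ _ _).
Qed.

Lemma emit_gstep_at e val p :
  emit u e val (gstep_at nd M p) =
  flatten (map E [seq step_term (@cell_step M) (val 3)
    (ival val p.1.1, ival val p.1.2, ival val p.2) y
    | y <- enum {: bool * S * S * S * S * S}]).
Proof.
case: p => [[jl jm] jr].
rewrite emit_gterms; congr (flatten (map E _)); apply: eq_map.
move=> [[[[[b c] l] m] r] s] /=; rewrite /ival /= addn0 addn1.
by [].
Qed.

Lemma emit_gstep : emit u 3 main_env (gstep nd M) =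
  flatten (map E (flatten [seq flatten [seq [seq step_term (@cell_step M) t p y |
      y <- enum {: bool * S * S * S * S * S}] | p <- positions N] |
    t <- iota 0 N])).
Proof.
rewrite flatten_map_flatten -map_comp emit_gfor; congr flatten.
apply: eq_map => t; rewrite /comp flatten_map_flatten -map_comp.
rewrite emit_gseq /positions -[(0, 0, 1) :: _]cat1s.
rewrite (map_cat _ [:: _]) map_cat !flatten_cat.
congr (_ ++ (_ ++ _)).
- by rewrite emit_gstep_at [RHS]cats0.
- rewrite emit_gfor -map_comp; congr flatten; apply: eq_map => j.
  rewrite emit_gstep_at /comp; congr (flatten (map E _)); apply: eq_map => y.
  by rewrite /ival /upd /= addn0 addn1 addn2.
- rewrite [RHS]cats0 [LHS]cats0 emit_gstep_at; congr (flatten (map E _)); apply: eq_map => y.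
  by rewrite /ival /upd /= addn0 addn1.
Qed.

Lemma emit_gfinal : emit u 3 main_env (gfinal nd M) =
  flatten (map E [seq final_term N s | s <- enum S & final_cell s]).
Proof.
rewrite emit_gterms; congr (flatten (map E _)); apply: eq_map => s.
by rewrite /= /ival /= addn0.
Qed.

Lemma emit_gcount w : emit u 3 main_env (gcount M w) =
  flatten (nseq (N.+1 * N.+2 * K) w).
Proof.
have H e val : val 2 = N.+2 ->
    emit u e val (GFor 2 (GEmit (flatten (nseq K w)))) = flatten (nseq (N.+2 * K) w).
  by move=> v2; rewrite emit_gfor v2 flatten_iota_const flatten_nseq_mul.
pose p := GFor 2 (GEmit (flatten (nseq K w))).
transitivity (emit u 3 main_env (GFor 1 p) ++ emit u 3 main_env p); first by [].
rewrite (H 3) // emit_gfor.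
rewrite (eq_map (g := fun=> flatten (nseq (N.+2 * K) w))) => [|j]; last exact: H.
rewrite flatten_iota_const flatten_nseq_mul -flatten_cat -nseqD.
by congr (flatten (nseq _ w)); rewrite -[RHS]mulnA mulSn addnC.
Qed.

Lemma size_emit_gpow e val k : 0 < e ->
  size (emit u e val (gpow k)) = val 0 ^ k.
Proof.
elim: k e val => [//|k IH] e val e0; rewrite emit_gfor size_flatten /shape -map_comp.
rewrite (eq_map (g := fun=> val 0 ^ k)) => [|j]; last first.
  by rewrite /= IH // /upd; case: eqP e0 => // <-.
have H (s : seq nat) : sumn [seq val 0 ^ k | _ <- s] = size s * val 0 ^ k.
  by elim: s => //= _ s ->; rewrite mulSn.
by rewrite H size_iota expnS.
Qed.

Lemma emit_gmain : emit u 1 (upd (fun=> 0) 0 (size u)) (gmain nd M d) =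
  emit u 3 main_env (ginstance nd M).
Proof.
set v := upd _ _ _.
transitivity (emit u 3 (upd (upd v 1 (size (emit u 2 v (gpow d) ++ nseq d true))) 2
  (size (emit u 3 (upd v 1 (size (emit u 2 v (gpow d) ++ nseq d true)))
    (GFor 1 (GEmit [:: true])) ++ [:: true; true]))) (ginstance nd M)).
  by [].
rewrite !size_cat size_emit_gpow // size_nseq emit_gfor flatten_iota_const.
by rewrite (flatten_nseq_const _ 1) size_nseq muln1 addn2.
Qed.

Lemma tree_rat_threshold : let e := (N.+1 * N.+2 * K)%N in
  tree_rat (threshold M d u) =
  SNode 0 [:: tree_nat (2 ^ e.+1).-1; tree_nat (2 ^ e.+1)].
Proof. by have [num den] := threshold_num_den (exponent M d u); rewrite /tree_rat num den. Qed.

Lemma emit_ginstance : emit u 3 main_env (ginstance nd M) =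
  encode (reduction nd M d u).
Proof.
change (emit u 3 main_env (ginstance nd M) = enc (tree_instance (reduction nd M d u))).
apply: emit_gnode; apply: emit_cons => //; apply: emit_cons; last apply: emit_cons;
  last apply: emit_cons => //; last apply: emit_cons => //.
- apply: emit_gnode; rewrite /constants !map_cat flatten_cat.
  congr (_ ++ _).
    rewrite emit_gfor -!map_comp; congr flatten; apply: eq_map => i.
    by rewrite emit_gunary /ival /upd /= addn0.
  rewrite [LHS]cats0 emit_gseq -!map_comp; congr flatten; apply: eq_map => i.
  exact: emit_gunary.
- apply: emit_gnode.
  transitivity (flatten (map E (machine_terms M d u))).
    transitivity (emit u 3 main_env (ginit nd M) ++ (emit u 3 main_env (gstep nd M) ++
        emit u 3 main_env (gfinal nd M))).
      by congr (_ ++ (_ ++ _)); exact: cats0.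
    by rewrite emit_ginit emit_gstep emit_gfinal -!flatten_cat -!map_cat.
  by rewrite /fact_abox -!map_comp.
- rewrite [i_thr _]/(threshold M d u) tree_rat_threshold.
  apply: emit_gnode; apply: emit_cons; last apply: emit_cons => //.
    rewrite /tree_nat enc_leaf bits_expn_pred emit_gseq.
    transitivity ([:: true] ++ (emit u 3 main_env (gcount M [:: true; true]) ++
      [:: true; true; false])); first by [].
    rewrite emit_gcount; move: (N.+1 * N.+2 * K)%N => e.
    (* The counting loop yields [e] bits with their prefixes; the fixed suffix supplies the last of
       the [e.+1] bits and the end of the token. *)
    rewrite (flatten_nseq_const _ 2); congr (true :: _).
    by rewrite map_nseq (flatten_nseq_const _ 2) mulSn addnC nseqD rcons_cat.
  rewrite /tree_nat enc_leaf bits_expn emit_gseq.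
  transitivity ([:: true] ++ (emit u 3 main_env (gcount M [:: true; false]) ++
    [:: true; false; true; true; false])); first by [].
  rewrite emit_gcount; move: (N.+1 * N.+2 * K)%N => e; congr (true :: _).
  rewrite map_rcons map_nseq -!cats1 flatten_cat -[_.+1]addn1 nseqD flatten_cat.
  by rewrite -!catA.
Qed.

End ProgramOutput.

Theorem theorem5 (R : realType) (nd : nat) (cds : 'I_nd -> concrete_domain) :
  exists (m : nat) (ar : 'I_m -> nat) (M : mln R m) (T : tbox nd m),
    [/\ mln_wf ar M, is_cmln M, range_restricted (map fst T)
      & PP_hard (data_problem cds ar M T)].
Proof.
exists 1, ar3, [::], [::]; split=> //.
- by split=> //; exact: List.NoDup_nil.
move=> L [M [d HM]]; exists (fun u => encode (reduction nd M d u)).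
  have := @polytime_gen (d + 10) _ (scoped_gmain nd M d).
  by under eq_fun do rewrite emit_gmain emit_ginstance.
by move=> u; apply: reduction_correct; have [] := HM u.
Qed.
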